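(* Let $n\ge1$, let $\mathcal{H}(\Sigma_{n+1})$ be the $0$-Hecke monoid of the symmetric group $\Sigma_{n+1}$, with generating set $X=\{T_1,\dots,T_n\}$, rule set $\mathbf{r}''$ and set $\mathcal{P}$ of pairs of parallel paths (listed explicitly in the context). Then $\langle X,\mathbf{r}'',\mathcal{P}\rangle$ is a coherent presentation of $\mathcal{H}(\Sigma_{n+1})$; i.e. for every category $\mathcal{C}$ the functor $$\mathrm{Res}_{\mathcal{P}}\colon[\mathcal{H}(\Sigma_{n+1});\mathcal{C}]\to[X,\mathbf{r}'',\mathcal{P};\mathcal{C}]$$ is an equivalence of categories.
   Context: The monoid. $M=\mathcal{H}(\Sigma_{n+1})$ is generated by $T_1,\dots,T_n$ subject to $T_iT_i=T_i$ ($1\le i\le n$), $T_{i+1}T_iT_{i+1}=T_iT_{i+1}T_i$ ($1\le i\le n-1$), $T_jT_i=T_iT_j$ ($1\le i\le j-2\le n-2$). Let $X=\{T_1,\dots,T_n\}$, and let $\mathbf{r}''$ be the set of rules $a_i=(T_iT_i,\,T_i)$ for $1\le i\le n$; $b_{k}=(T_kT_{k-1}T_k,\,T_{k-1}T_kT_{k-1})$ for $2\le k\le n$; $c_{st}=(T_sT_t,\,T_tT_s)$ for all $1\le s,t\le n$ with $|s-t|\ge2$. Then $\langle X,\mathbf{r}''\rangle$ is a presentation of $M$. The category $[M;\mathcal{C}]$, for a monoid $M$ with neutral element $e$. An action $(F,\lambda)$ of $M$ on $\mathcal{C}$ consists of endofunctors $F_a\colon\mathcal{C}\to\mathcal{C}$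 ($a\in M$), a natural isomorphism $\eta\colon F_e\to\mathrm{Id}$, and natural isomorphisms $\lambda_{a,b}\colon F_aF_b\to F_{ab}$ such that $\lambda_{ab,c}\circ(\lambda_{a,b}F_c)=\lambda_{a,bc}\circ(F_a\lambda_{b,c})$ for all $a,b,c\in M$, and $\lambda_{e,a}$, $\lambda_{a,e}$ are induced by $\eta$ (i.e. $\lambda_{e,a}=\eta F_a$, $\lambda_{a,e}=F_a\eta$). A morphism $(F,\lambda)\to(F',\lambda')$ is a collection of natural transformations $\rho_a\colon F_a\to F'_a$ ($a\in M$) with $\rho_{ab}\circ\lambda_{a,b}=\lambda'_{a,b}\circ(\rho_a\rho_b)$ for all $a,b$ (horizontal composite) and $\eta'\circ\rho_e=\eta$. For $k\ge3$, $\lambda_{a_1,\dots,a_k}=\lambda_{a_1,a_2\cdots a_k}\circ F_{a_1}(\lambda_{a_2,\dots,a_k})\colon F_{a_1}\cdots F_{a_k}\to F_{a_1\cdots a_k}$, recursively; for $k=1$ it is the identity. The category $[X,\mathbf{r}'';\mathcal{C}]$. Objects are pairs $(F,\tau)=((F_x)_{x\in X},(\tau_r)_{r\in\mathbf{r}''})$ with $F_x$ endofunctors of $\mathcal{C}$ and, for each $r=(x_1\cdots x_k,\,y_1\cdots y_l)\in\mathbf{r}''$, $\tau_r\colon F_{x_1}\cdots F_{x_k}\to F_{y_1}\cdots F_{y_l}$ a natural isomorphism. Morphisms $(F,\tau)\to(F',\tau')$ are families of natural transformations $\rho_x\colon F_x\to F'_x$ ($x\in X$) with $(\rho_{y_1}\cdots\rho_{y_l})\circ\tau_r=\tau'_r\circ(\rho_{x_1}\cdots\rho_{x_k})$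 for all such $r$. The restriction functor $\mathrm{Res}\colon[M;\mathcal{C}]\to[X,\mathbf{r}'';\mathcal{C}]$ sends $(F,\lambda)$ to $((F_x)_{x\in X},(\tau_r))$ with $\tau_r=\lambda_{y_1,\dots,y_l}^{-1}\circ\lambda_{x_1,\dots,x_k}$, and sends $(\rho_a)_{a\in M}$ to $(\rho_x)_{x\in X}$. Steps and paths. Let $X^*$ be the free monoid on $X$. Steps are $w_1rw_2\colon w_1uw_2\to w_1vw_2$ with $w_1,w_2\in X^*$, $r=(u,v)\in\mathbf{r}''$; a path is a finite (possibly empty) sequence of consecutive steps. For $(F,\tau)\in[X,\mathbf{r}'';\mathcal{C}]$ put $F_{x_1\cdots x_k}=F_{x_1}\cdots F_{x_k}$, $\tau_{w_1rw_2}=F_{w_1}\tau_rF_{w_2}$, and let $\tau_p$ be the composite of the $\tau$'s of the steps along a path $p$ (identity for empty paths). $[X,\mathbf{r}'',\mathcal{P};\mathcal{C}]$ is the full subcategory of $[X,\mathbf{r}'';\mathcal{C}]$ on the $(F,\tau)$ with $\tau_p=\tau_q$ for all $(p,q)\in\mathcal{P}$. $\mathrm{Res}$ takes values in it; $\mathrm{Res}_{\mathcal{P}}$ is the resulting functor. The set $\mathcal{P}$. Write $i$ for $T_i$, $k'=k-1$, $\widehat{k}=k+1$. In each item the two listed paths (given by their successive steps) form a pair in $\mathcal{P}$; the indices range over all values in $\{1,\dots,n\}$ for which all letters and rules involved are defined. (1) from $st$ to $st$: $c_{st},\,c_{ts}$; and the empty path. (2) from $kkk$ to $k$: $ka_k,\,a_k$;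 and $a_kk,\,a_k$. (3) from $kk'kk$ to $k'kk'$: $kk'a_k,\ b_k$; and $b_kk,\ k'b_k,\ a_{k'}kk'$. (4) from $kkk'k$ to $k'kk'$: $kb_k,\ b_kk',\ k'ka_{k'}$; and $a_kk'k,\ b_k$. (5) from $stt$ to $ts$: $sa_t,\ c_{st}$; and $c_{st}t,\ tc_{st},\ a_ts$. (6) from $kk'kk'k$ to $k'kk'$: $kk'b_k,\ ka_{k'}kk',\ b_kk',\ k'ka_{k'}$; and $b_kk'k,\ k'ka_{k'}k,\ k'b_k,\ a_{k'}kk'$. (7) from $tss's$ to $s'ss't$: $tb_s,\ c_{ts'}ss',\ s'c_{ts}s',\ s'sc_{ts'}$; and $c_{ts}s's,\ sc_{ts'}s,\ ss'c_{ts},\ b_st$. (8) from $kji$ to $ijk$: $kc_{ji},\ c_{ki}j,\ ic_{kj}$; and $c_{kj}i,\ jc_{ki},\ c_{ji}k$. (9) from $\widehat{k}kk'\widehat{k}k\widehat{k}$ to $k'kk'\widehat{k}kk'$: $\widehat{k}kk'b_{\widehat{k}},\ \widehat{k}b_k\widehat{k}k,\ c_{\widehat{k}k'}kk'\widehat{k}k,\ k'\widehat{k}kc_{k'\widehat{k}}k,\ k'b_{\widehat{k}}k'k,\ k'k\widehat{k}b_k,\ k'kc_{\widehat{k}k'}kk'$; and $\widehat{k}kc_{k'\widehat{k}}k\widehat{k},\ b_{\widehat{k}}k'k\widehat{k},\ k\widehat{k}b_k\widehat{k},\ kc_{\widehat{k}k'}kk'\widehat{k},\ kk'\widehat{k}kc_{k'\widehat{k}},\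 kk'b_{\widehat{k}}k',\ b_k\widehat{k}kk'$. *)

(* Defs.v *)
(* MathComp, with the classical axioms of mathcomp.classical.boolp. *)
From HB Require Import structures.
From Stdlib Require Import Relation_Operators.
From mathcomp Require Import all_boot generic_quotient.
From mathcomp Require Import boolp.

Set Implicit Arguments.
Unset Strict Implicit.
Unset Printing Implicit Defensive.
#[local] Obligation Tactic := idtac.

Declare Scope cat_scope.
Delimit Scope cat_scope with cat.

(* Hom-types carry Leibniz equality; objects are never compared by equality. *)
Record category := Category {
  ob :> Type;
  hom : ob -> ob -> Type;
  idm : forall x, hom x x;
  cmp : forall x y z, hom y z -> hom x y -> hom x z;
  cmp1m : forall x y (f : hom x y), cmp (idm y) f = f;
  cmpm1 : forall x y (f : hom x y), cmp f (idm x) = f;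
  cmpA : forall x y z t (h : hom z t) (g : hom y z) (f : hom x y),
    cmp h (cmp g f) = cmp (cmp h g) f
}.
Arguments hom {c} x y.
Arguments idm {c} x.
Arguments cmp {c x y z} g f.
Notation "g \c f" := (cmp g f)
  (at level 50, left associativity, format "g  \c  f") : cat_scope.
Local Open Scope cat_scope.

Record functor (C D : category) := Functor {
  fob :> C -> D;
  fmap : forall x y, hom x y -> hom (fob x) (fob y);
  fmap1 : forall x, fmap (idm x) = idm (fob x);
  fmapM : forall x y z (g : hom y z) (f : hom x y),
    fmap (g \c f) = fmap g \c fmap f
}.
Arguments fmap {C D} F {x y} f : rename.

Definition fid (C : category) : functor C C :=
  @Functor C C id (fun _ _ f => f) (fun _ => erefl) (fun _ _ _ _ _ => erefl).

Program Definition fcomp (C D E : category) (G : functor D E) (F : functor C D)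
  : functor C E :=
  @Functor C E (fun x => G (F x)) (fun _ _ f => fmap G (fmap F f)) _ _.
Next Obligation. by move=> * /=; rewrite !fmap1. Qed.
Next Obligation. by move=> * /=; rewrite !fmapM. Qed.

Record nat_trans (C D : category) (F G : functor C D) := NatTrans {
  ntc :> forall x, hom (F x) (G x);
  ntN : forall x y (f : hom x y), fmap G f \c ntc x = ntc y \c fmap F f
}.

Record nat_iso (C D : category) (F G : functor C D) := NatIso {
  fwd :> nat_trans F G;
  bwd : nat_trans G F;
  fwdK : forall x, bwd x \c fwd x = idm (F x);
  bwdK : forall x, fwd x \c bwd x = idm (G x)
}.

Definition is_equivalence (C D : category) (F : functor C D) : Prop :=
  exists G : functor D C,
    inhabited (nat_iso (fcomp G F) (fid C)) /\
    inhabited (nat_iso (fcomp F G) (fid D)).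

Lemma nat_trans_ext (C D : category) (F G : functor C D) (s t : nat_trans F G) :
  (forall x, s x = t x) -> s = t.
Proof.
case: s t => s sN [t tN] /= st.
have {}st : s = t by apply: functional_extensionality_dep.
by subst t; congr NatTrans; apply: Prop_irrelevance.
Qed.

Section NatTransOps.
Variables C D E : category.

Program Definition nt_id (F : functor C D) : nat_trans F F :=
  @NatTrans _ _ F F (fun x => idm (F x)) _.
Next Obligation. by move=> * /=; rewrite cmpm1 cmp1m. Qed.

Program Definition nt_comp (F G H : functor C D)
    (t : nat_trans G H) (s : nat_trans F G) : nat_trans F H :=
  @NatTrans _ _ F H (fun x => t x \c s x) _.
Next Obligation. by move=> F G H t s x y f; rewrite cmpA ntN -cmpA ntN cmpA. Qed.

(* Left whiskering [G s] and right whiskering [s G]. *)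
Program Definition nt_whiskl (G : functor D E) (F F' : functor C D)
    (s : nat_trans F F') : nat_trans (fcomp G F) (fcomp G F') :=
  @NatTrans _ _ (fcomp G F) (fcomp G F') (fun x => fmap G (s x)) _.
Next Obligation. by move=> * /=; rewrite -!fmapM ntN. Qed.

Definition nt_whiskr (F F' : functor D E) (s : nat_trans F F')
    (G : functor C D) : nat_trans (fcomp F G) (fcomp F' G) :=
  @NatTrans _ _ (fcomp F G) (fcomp F' G) (fun x => s (G x))
    (fun _ _ f => ntN s (fmap G f)).

End NatTransOps.

Definition nt_hcomp (C D E : category) (F F' : functor D E)
    (G G' : functor C D) (s : nat_trans F F') (t : nat_trans G G') :
    nat_trans (fcomp F G) (fcomp F' G') :=
  nt_comp (nt_whiskr s G') (nt_whiskl F t).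

Lemma bwdP (C D : category) (F G : functor C D) (s : nat_iso F G) x y
    (f : hom y (F x)) (h : hom y (G x)) :
  s x \c f = h <-> f = bwd s x \c h.
Proof. by split=> [<-|->]; rewrite cmpA ?fwdK ?bwdK cmp1m. Qed.

Section NatIsoOps.
Variables C D E : category.

Definition ni_id (F : functor C D) : nat_iso F F :=
  @NatIso _ _ F F (nt_id F) (nt_id F)
    (fun x => cmp1m (idm (F x))) (fun x => cmp1m (idm (F x))).

Definition ni_sym (F G : functor C D) (s : nat_iso F G) : nat_iso G F :=
  NatIso (bwdK s) (fwdK s).

Program Definition ni_comp (F G H : functor C D)
    (t : nat_iso G H) (s : nat_iso F G) : nat_iso F H :=
  @NatIso _ _ F H (nt_comp t s) (nt_comp (bwd s) (bwd t)) _ _.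
Next Obligation.
by move=> F G H t s x /=; rewrite cmpA -[bwd s x \c _ \c _]cmpA fwdK cmpm1 fwdK.
Qed.
Next Obligation.
by move=> F G H t s x /=; rewrite cmpA -[fwd t x \c _ \c _]cmpA bwdK cmpm1 bwdK.
Qed.

Program Definition ni_whiskl (G : functor D E) (F F' : functor C D)
    (s : nat_iso F F') : nat_iso (fcomp G F) (fcomp G F') :=
  @NatIso _ _ (fcomp G F) (fcomp G F')
    (nt_whiskl G s) (nt_whiskl G (bwd s)) _ _.
Next Obligation. by move=> * /=; rewrite -fmapM fwdK fmap1. Qed.
Next Obligation. by move=> * /=; rewrite -fmapM bwdK fmap1. Qed.

End NatIsoOps.

(* Composition of functors is strictly associative and unital on objects and
   on morphisms; the components of the following isomorphisms are identities. *)
Section CanonicalIsos.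
Variables B C D E : category.

Program Definition ni_unitr (F : functor C D) : nat_iso (fcomp F (fid C)) F :=
  @NatIso _ _ (fcomp F (fid C)) F
    (@NatTrans _ _ (fcomp F (fid C)) F (fun x => idm (F x)) _)
    (@NatTrans _ _ F (fcomp F (fid C)) (fun x => idm (F x)) _) _ _.
Next Obligation. by move=> * /=; rewrite cmpm1 cmp1m. Qed.
Next Obligation. by move=> * /=; rewrite cmpm1 cmp1m. Qed.
Next Obligation. by move=> * /=; rewrite cmpm1. Qed.
Next Obligation. by move=> * /=; rewrite cmpm1. Qed.

Program Definition ni_unitl (F : functor C D) : nat_iso (fcomp (fid D) F) F :=
  @NatIso _ _ (fcomp (fid D) F) F
    (@NatTrans _ _ (fcomp (fid D) F) F (fun x => idm (F x)) _)
    (@NatTrans _ _ F (fcomp (fid D) F) (fun x => idm (F x)) _) _ _.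
Next Obligation. by move=> * /=; rewrite cmpm1 cmp1m. Qed.
Next Obligation. by move=> * /=; rewrite cmpm1 cmp1m. Qed.
Next Obligation. by move=> * /=; rewrite cmpm1. Qed.
Next Obligation. by move=> * /=; rewrite cmpm1. Qed.

Program Definition ni_assoc (H : functor D E) (G : functor C D)
    (F : functor B C) :
    nat_iso (fcomp H (fcomp G F)) (fcomp (fcomp H G) F) :=
  @NatIso _ _ (fcomp H (fcomp G F)) (fcomp (fcomp H G) F)
    (@NatTrans _ _ (fcomp H (fcomp G F)) (fcomp (fcomp H G) F)
       (fun x => idm (H (G (F x)))) _)
    (@NatTrans _ _ (fcomp (fcomp H G) F) (fcomp H (fcomp G F))
       (fun x => idm (H (G (F x)))) _) _ _.
Next Obligation. by move=> * /=; rewrite cmpm1 cmp1m. Qed.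
Next Obligation. by move=> * /=; rewrite cmpm1 cmp1m. Qed.
Next Obligation. by move=> * /=; rewrite cmpm1. Qed.
Next Obligation. by move=> * /=; rewrite cmpm1. Qed.

End CanonicalIsos.

Section FullSubcategory.
Variables (C : category) (P : C -> Prop).

Definition full_subcat : category :=
  @Category {x : C | P x} (fun x y => hom (sval x) (sval y))
    (fun x => idm (sval x)) (fun _ _ _ g f => g \c f)
    (fun _ _ f => cmp1m f) (fun _ _ f => cmpm1 f)
    (fun _ _ _ _ h g f => cmpA h g f).

Definition corestrict (B : category) (F : functor B C)
    (FP : forall b, P (F b)) : functor B full_subcat :=
  @Functor B full_subcat (fun b => exist _ (F b) (FP b))
    (fun _ _ f => fmap F f) (fmap1 F) (@fmapM _ _ F).

End FullSubcategory.

Section Words.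
Variables (X : Type) (C : category).
Implicit Types (F : X -> functor C C) (w : seq X).

Fixpoint wordF F w : functor C C :=
  if w is x :: w' then fcomp (F x) (wordF F w') else fid C.

(* Horizontal composites of families of transformations. *)
Fixpoint wordN F F' (rho : forall x, nat_trans (F x) (F' x)) w :
    nat_trans (wordF F w) (wordF F' w) :=
  if w is x :: w' then nt_hcomp (rho x) (wordN rho w') else nt_id (fid C).

(* On objects [wordF F (u ++ w)] and [wordF F u \o wordF F w] agree, but only
   up to propositional equality when [u] is a variable; this is the identity
   transformation between them. *)
Fixpoint word_cat F u w :
    nat_iso (wordF F (u ++ w)) (fcomp (wordF F u) (wordF F w)) :=
  match u return
    nat_iso (wordF F (u ++ w)) (fcomp (wordF F u) (wordF F w)) with
  | [::] => ni_sym (ni_unitl (wordF F w))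
  | x :: u' =>
      ni_comp (ni_assoc (F x) (wordF F u') (wordF F w))
              (ni_whiskl (F x) (word_cat F u' w))
  end.

End Words.

Section Actions.
Variables (M : monoidType) (C : category).
Local Open Scope group_scope.

(* [fam_eq F e] is the identity transformation; it mediates between indices
   that are equal, but not convertible, elements of the monoid. *)
Definition fam_eq (F : M -> functor C C) (a b : M) (e : a = b) :
    nat_iso (F a) (F b) :=
  match e with erefl => ni_id (F a) end.

Record action := Action {
  act :> M -> functor C C;
  act_eta : nat_iso (act 1) (fid C);
  act_lam : forall a b, nat_iso (fcomp (act a) (act b)) (act (a * b));
  act_lamA : forall a b c x,
    act_lam (a * b) c x \c act_lam a b (act c x) =
    fam_eq act (mulgA a b c) x \c
      (act_lam a (b * c) x \c fmap (act a) (act_lam b c x));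
  act_lam1g : forall a x,
    fam_eq act (mul1g a) x \c act_lam 1 a x = act_eta (act a x);
  act_lamg1 : forall a x,
    fam_eq act (mulg1 a) x \c act_lam a 1 x = fmap (act a) (act_eta x)
}.

Record action_mor (F F' : action) := ActionMor {
  amor :> forall a, nat_trans (F a) (F' a);
  amor_lam : forall a b x,
    amor (a * b) x \c act_lam F a b x =
    act_lam F' a b x \c nt_hcomp (amor a) (amor b) x;
  amor_eta : forall x, act_eta F' x \c amor 1 x = act_eta F x
}.

Lemma action_mor_ext (F F' : action) (r s : action_mor F F') :
  (forall a x, r a x = s a x) -> r = s.
Proof.
case: r s => r r1 r2 [s s1 s2] /= rs.
have {}rs : r = s.
  by apply: functional_extensionality_dep => a; apply: nat_trans_ext.
by subst s; congr ActionMor; apply: Prop_irrelevance.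
Qed.

Program Definition amor_id (F : action) : action_mor F F :=
  @ActionMor F F (fun a => nt_id (F a)) _ _.
Next Obligation. by move=> * /=; rewrite /= fmap1 !(cmpm1, cmp1m). Qed.
Next Obligation. by move=> * /=; rewrite /= cmpm1. Qed.

Program Definition amor_comp (F G H : action)
    (s : action_mor G H) (r : action_mor F G) : action_mor F H :=
  @ActionMor F H (fun a => nt_comp (s a) (r a)) _ _.
Next Obligation.
move=> F G H s r a b x.
move: (amor_lam r a b x) (amor_lam s a b x) => /= Er Es.
rewrite -cmpA Er cmpA Es -!cmpA.
congr (_ \c _); rewrite /= fmapM !cmpA; congr (_ \c _).
by rewrite -!cmpA; congr (_ \c _); rewrite ntN.
Qed.
Next Obligation. by move=> * /=; rewrite /= cmpA !amor_eta. Qed.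

Program Definition action_cat : category :=
  @Category action action_mor amor_id amor_comp _ _ _.
Next Obligation. by move=> *; apply: action_mor_ext => a x /=; rewrite cmp1m. Qed.
Next Obligation. by move=> *; apply: action_mor_ext => a x /=; rewrite cmpm1. Qed.
Next Obligation. by move=> *; apply: action_mor_ext => a x /=; rewrite cmpA. Qed.

(* [evalw1 g a w] is the product g(a) (g(w_1) (... g(w_k))); the value on a
   one-letter word is g(a), without a trailing unit. *)
Fixpoint evalw1 (X : Type) (g : X -> M) (a : X) (w : seq X) : M :=
  if w is b :: w' then g a * evalw1 g b w' else g a.

Definition evalw (X : Type) (g : X -> M) (w : seq X) : M :=
  if w is a :: w' then evalw1 g a w' else 1.

(* The isomorphisms lambda for (a_1, .., a_k), k >= 1, for a_i = g(x_i). *)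
Fixpoint lamw1 (F : action) (X : Type) (g : X -> M) (a : X) (w : seq X) :
    nat_iso (wordF (F \o g) (a :: w)) (F (evalw1 g a w)) :=
  match w return nat_iso (wordF (F \o g) (a :: w)) (F (evalw1 g a w)) with
  | [::] => ni_unitr (F (g a))
  | b :: w' =>
      ni_comp (act_lam F (g a) (evalw1 g b w'))
              (ni_whiskl (F (g a)) (lamw1 F g b w'))
  end.

(* The empty word, for which lambda is the inverse of eta, is included so that
   arbitrary rules make sense. *)
Definition lamw (F : action) (X : Type) (g : X -> M) (w : seq X) :
    nat_iso (wordF (F \o g) w) (F (evalw g w)) :=
  match w return nat_iso (wordF (F \o g) w) (F (evalw g w)) with
  | [::] => ni_sym (act_eta F)
  | a :: w' => lamw1 F g a w'
  end.

End Actions.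
Arguments fam_eq {M C} F {a b} e.

(* A set of rules is given by an indexing type [rule] and the two sides of each
   rule. *)
Record rewriting_system := RewritingSystem {
  letter : Type;
  rule : Type;
  lhs : rule -> seq letter;
  rhs : rule -> seq letter
}.
Arguments lhs {r} _ : rename.
Arguments rhs {r} _ : rename.

Section Paths.
Variable S : rewriting_system.
Local Notation word := (seq (letter S)).

Inductive step : word -> word -> Type :=
  Step (w1 : word) (r : rule S) (w2 : word) :
    step (w1 ++ (lhs r ++ w2)) (w1 ++ (rhs r ++ w2)).

Inductive rpath : word -> word -> Type :=
| pnil u : rpath u u
| pcons u v w (s : step u v) (p : rpath v w) : rpath u w.

Definition path_relation := forall u v, rpath u v -> rpath u v -> Prop.

End Paths.
Arguments Step {S} w1 r w2.
Arguments pnil {S u}.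
Arguments pcons {S u v w} s p.

Section PresentedActions.
Variables (S : rewriting_system) (C : category).

Record paction := PAction {
  pact :> letter S -> functor C C;
  pact_tau : forall r : rule S,
    nat_iso (wordF pact (lhs r)) (wordF pact (rhs r))
}.

Record paction_mor (F F' : paction) := PActionMor {
  pmor :> forall x, nat_trans (F x) (F' x);
  pmor_tau : forall r c,
    wordN pmor (rhs r) c \c pact_tau F r c =
    pact_tau F' r c \c wordN pmor (lhs r) c
}.

Lemma paction_mor_ext (F F' : paction) (r s : paction_mor F F') :
  (forall x c, r x c = s x c) -> r = s.
Proof.
case: r s => r r1 [s s1] /= rs.
have {}rs : r = s.
  by apply: functional_extensionality_dep => x; apply: nat_trans_ext.
by subst s; congr PActionMor; apply: Prop_irrelevance.
Qed.

Lemma wordN_id (F : letter S -> functor C C) w c :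
  wordN (fun x => nt_id (F x)) w c = idm _.
Proof. by elim: w => //= x w ->; rewrite fmap1 cmpm1. Qed.

Lemma wordN_comp (F G H : letter S -> functor C C)
    (s : forall x, nat_trans (G x) (H x)) (r : forall x, nat_trans (F x) (G x))
    w c :
  wordN (fun x => nt_comp (s x) (r x)) w c = wordN s w c \c wordN r w c.
Proof.
elim: w => [|x w /= ->] /=; first by rewrite cmp1m.
rewrite fmapM !cmpA; congr (_ \c _).
by rewrite -!cmpA; congr (_ \c _); rewrite ntN.
Qed.

Program Definition pmor_id (F : paction) : paction_mor F F :=
  @PActionMor F F (fun x => nt_id (F x)) _.
Next Obligation. by move=> * /=; rewrite !wordN_id cmpm1 cmp1m. Qed.

Program Definition pmor_comp (F G H : paction)
    (s : paction_mor G H) (r : paction_mor F G) : paction_mor F H :=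
  @PActionMor F H (fun x => nt_comp (s x) (r x)) _.
Next Obligation.
by move=> F G H s r q c; rewrite !wordN_comp -cmpA !pmor_tau !cmpA pmor_tau.
Qed.

Program Definition paction_cat : category :=
  @Category paction paction_mor pmor_id pmor_comp _ _ _.
Next Obligation. by move=> *; apply: paction_mor_ext => x c /=; rewrite cmp1m. Qed.
Next Obligation. by move=> *; apply: paction_mor_ext => x c /=; rewrite cmpm1. Qed.
Next Obligation. by move=> *; apply: paction_mor_ext => x c /=; rewrite cmpA. Qed.

(* F_(w1) tau_r F_(w2). *)
Definition tau_step (F : paction) u v (s : step u v) :
    nat_trans (wordF F u) (wordF F v) :=
  match s in step u v return nat_trans (wordF F u) (wordF F v) with
  | Step w1 r w2 =>
      nt_comp (bwd (word_cat F w1 (rhs r ++ w2)))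
     (nt_comp (nt_whiskl (wordF F w1)
                 (nt_comp (bwd (word_cat F (rhs r) w2))
                 (nt_comp (nt_whiskr (pact_tau F r) (wordF F w2))
                          (word_cat F (lhs r) w2))))
              (word_cat F w1 (lhs r ++ w2)))
  end.

Fixpoint tau_path (F : paction) u v (p : rpath u v) :
    nat_trans (wordF F u) (wordF F v) :=
  match p in rpath u v return nat_trans (wordF F u) (wordF F v) with
  | pnil u => nt_id (wordF F u)
  | pcons u v w s p => nt_comp (tau_path F p) (tau_step F s)
  end.

Definition satisfies (P : path_relation S) (F : paction) : Prop :=
  forall u v (p q : rpath u v), P u v p q ->
  forall c, tau_path F p c = tau_path F q c.

Definition paction_P_cat (P : path_relation S) : category :=
  @full_subcat paction_cat (satisfies P).

End PresentedActions.

(* [S] presents [M]: the letters generate [M], and two words have the same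
   value exactly when the rules identify them. *)
Record presentation (M : monoidType) := Presentation {
  pres :> rewriting_system;
  gen : letter pres -> M;
  gen_surj : forall a : M, exists w, evalw gen w = a;
  gen_eq : forall u v, evalw gen u = evalw gen v <->
    clos_refl_sym_trans _ (fun u v => inhabited (step u v)) u v
}.

Section Restriction.
Variables (M : monoidType) (S : presentation M) (C : category).
Local Notation word := (seq (letter S)).
Local Notation action := (action M C).
Local Notation g := (@gen M S).
Local Open Scope group_scope.

Lemma gen_step u v : step u v -> evalw g u = evalw g v :> M.
Proof. by move=> s; apply/gen_eq; apply: rst_step. Qed.

Lemma gen_rule (r : rule S) : evalw g (lhs r) = evalw g (rhs r) :> M.
Proof. by have /gen_step := Step [::] r [::]; rewrite /= !cats0. Qed.

Definition res_ob (F : action) : paction S C :=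
  @PAction S C (F \o g) (fun r =>
    ni_comp (ni_sym (lamw F g (rhs r)))
      (ni_comp (fam_eq F (gen_rule r)) (lamw F g (lhs r)))).

Lemma lamw_nat (F F' : action) (rho : action_mor F F') w c :
  lamw F' g w c \c wordN (fun x => rho (g x)) w c =
  rho (evalw g w) c \c lamw F g w c.
Proof.
case: w => [|x w] /=.
  move: (amor_eta rho c) (bwdK (act_eta F) c) (fwdK (act_eta F') c) => /= E K K'.
  by rewrite -K -E !cmpA K' cmp1m.
elim: w x => [|y w IH] x; first by rewrite /= fmap1 !cmpm1 cmp1m.
move: (amor_lam rho (g x) (evalw1 g y w) c) (IH y) => /= E {}IH.
rewrite cmpA E -!cmpA; congr (_ \c _); rewrite -fmapM -IH [in RHS]fmapM !cmpA.
by congr (_ \c _); rewrite ntN.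
Qed.

Lemma fam_eq_nat (F F' : action) (rho : action_mor F F') a b (e : a = b) c :
  fam_eq F' e c \c rho a c = rho b c \c fam_eq F e c.
Proof. by case: b / e; rewrite /= cmpm1 cmp1m. Qed.

Program Definition res_mor (F F' : action) (rho : action_mor F F') :
    paction_mor (res_ob F) (res_ob F') :=
  @PActionMor S C (res_ob F) (res_ob F') (fun x => rho (g x)) _.
Next Obligation.
move=> F F' rho r c.
move: (lamw_nat rho (lhs r) c) (lamw_nat rho (rhs r) c) => /= El Er.
move: (fam_eq_nat rho (gen_rule r) c) => /= E.
rewrite -!cmpA; apply/bwdP; rewrite El !cmpA Er E; congr (_ \c _); congr (_ \c _).
by rewrite -cmpA bwdK cmpm1.
Qed.

Program Definition Res : functor (action_cat M C) (paction_cat S C) :=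
  @Functor (action_cat M C) (paction_cat S C) res_ob res_mor _ _.
Next Obligation. by move=> F; apply: paction_mor_ext. Qed.
Next Obligation. by move=> *; apply: paction_mor_ext. Qed.

(* In [Res F], the transformation along a path is determined by its endpoints.
   The proof compares morphisms up to the identities [fam_eq]. *)
Section PathIndependence.
Variable F : action.
Local Notation WF := (wordF (fun x => F (g x))).

Definition eqF c X a b (f : hom X (F a c)) (h : hom X (F b c)) : Prop :=
  exists e : a = b, fam_eq F e c \c f = h.
Arguments eqF : clear implicits.
Arguments eqF {c X a b} f h.

Lemma eqF_refl c X a (f : hom X (F a c)) : eqF f f.
Proof. by exists erefl; rewrite /= cmp1m. Qed.

Lemma eqF_sym c X a b (f : hom X (F a c)) (h : hom X (F b c)) :
  eqF f h -> eqF h f.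
Proof. by case=> e; case: b / e h => h <- /=; rewrite cmp1m; apply: eqF_refl. Qed.

Lemma eqF_trans c X a b d (f : hom X (F a c)) (h : hom X (F b c))
    (k : hom X (F d c)) : eqF f h -> eqF h k -> eqF f k.
Proof. by case=> e; case: b / e h => h <- /=; rewrite cmp1m. Qed.

Lemma eqF_cmp c X Y a b (f : hom X (F a c)) (h : hom X (F b c)) (k : hom Y X) :
  eqF f h -> eqF (f \c k) (h \c k).
Proof. by case=> e <-; exists e; rewrite cmpA. Qed.

Lemma eqF_lamr c X Y a b b' (G : functor C C) (t : nat_trans G (F a))
    (f : hom X (F b c)) (h : hom X (F b' c)) (k : hom Y (G X)) :
  eqF f h ->
  eqF (act_lam F a b c \c (t (F b c) \c (fmap G f \c k)))
      (act_lam F a b' c \c (t (F b' c) \c (fmap G h \c k))).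
Proof. by case=> e; case: b' / e h => h <- /=; rewrite cmp1m; apply: eqF_refl. Qed.

Lemma eqF_laml c X a a' b (f : hom X (F a (F b c))) (h : hom X (F a' (F b c))) :
  eqF f h -> eqF (act_lam F a b c \c f) (act_lam F a' b c \c h).
Proof. by case=> e; case: a' / e h => h <- /=; rewrite cmp1m; apply: eqF_refl. Qed.

Let ev := foldr (fun x m => g x * m) (1 : M).

Fixpoint ulam w : nat_trans (WF w) (F (ev w)) :=
  match w return nat_trans (WF w) (F (ev w)) with
  | [::] => bwd (act_eta F)
  | x :: w' => nt_comp (act_lam F (g x) (ev w')) (nt_whiskl (F (g x)) (ulam w'))
  end.

Lemma lamw_ulam w c : eqF (lamw F g w c) (ulam w c).
Proof.
case: w => [|x w] /=; first exact: eqF_refl.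
elim: w x => [|y w IH] x /=.
  apply: eqF_sym; exists (mulg1 (g x)).
  move: (act_lamg1 F (g x) c) (bwdK (act_eta F) c) => /= E K.
  by rewrite cmpA E -fmapM K fmap1.
move: (eqF_lamr (nt_id (F (g x))) (idm _) (IH y)).
by rewrite /= !cmpm1 !cmp1m.
Qed.

Lemma ulam_cat u w c :
  eqF (ulam (u ++ w) c)
      (act_lam F (ev u) (ev w) c \c
        (ulam u (F (ev w) c) \c
          (fmap (WF u) (ulam w c) \c
            word_cat (fun x => F (g x)) u w c))).
Proof.
elim: u => [|x u IH] /=.
  apply: eqF_sym; exists (mul1g (ev w)).
  move: (act_lam1g F (ev w) c) (bwdK (act_eta F) (F (ev w) c)) => /= E K.
  by rewrite cmpA E cmpA K cmpm1 cmp1m.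
move: (eqF_lamr (nt_id (F (g x))) (idm _) IH).
rewrite /= !cmpm1 !cmp1m => {}IH; apply: eqF_trans IH _.
exists (mulgA (g x) (ev u) (ev w)).
move: (act_lamA F (g x) (ev u) (ev w) c) => /= E.
by rewrite !fmapM !cmpA; move: E; rewrite !cmpA => <-.
Qed.

Lemma ulam_rule r c :
  eqF (ulam (rhs r) c \c pact_tau (res_ob F) r c) (ulam (lhs r) c).
Proof.
apply: eqF_trans (eqF_cmp _ (eqF_sym (lamw_ulam _ _))) _.
apply: eqF_trans (lamw_ulam (lhs r) c); apply: eqF_sym.
exists (gen_rule r); move: (bwdK (lamw F g (rhs r)) c) => /= K.
by rewrite !cmpA K cmp1m.
Qed.

Lemma ulam_step u v (s : step u v) c :
  eqF (ulam v c \c tau_step (res_ob F) s c) (ulam u c).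
Proof.
case: s => w1 r w2 /=.
set K := bwd (word_cat _ (rhs r) w2) c \c _.
have inner : eqF (ulam (rhs r ++ w2) c \c K) (ulam (lhs r ++ w2) c).
  apply: eqF_trans (eqF_cmp _ (ulam_cat (rhs r) w2 c)) _.
  apply: eqF_trans (eqF_sym (ulam_cat (lhs r) w2 c)).
  have cK : word_cat (fun x => F (g x)) (rhs r) w2 c \c K =
      pact_tau (res_ob F) r (WF w2 c) \c
        word_cat (fun x => F (g x)) (lhs r) w2 c.
    by apply/bwdP.
  move: (ntN (pact_tau (res_ob F) r) (ulam w2 c)) => N.
  rewrite -!cmpA cK; apply: eqF_laml.
  rewrite [fmap _ _ \c _]cmpA N -cmpA cmpA.
  exact: eqF_cmp (ulam_rule r _).
apply: eqF_trans (eqF_cmp _ (ulam_cat w1 (rhs r ++ w2) c)) _.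
apply: eqF_trans (eqF_sym (ulam_cat w1 (lhs r ++ w2) c)).
have cK : word_cat (fun x => F (g x)) w1 (rhs r ++ w2) c \c
    (bwd (word_cat (fun x => F (g x)) w1 (rhs r ++ w2)) c \c
      (fmap (WF w1) K \c word_cat (fun x => F (g x)) w1 (lhs r ++ w2) c)) =
    fmap (WF w1) K \c word_cat (fun x => F (g x)) w1 (lhs r ++ w2) c.
  by apply/bwdP.
rewrite -!cmpA cK [fmap _ _ \c (_ \c _)]cmpA -fmapM.
exact: eqF_lamr inner.
Qed.

Lemma ulam_path u v (p : rpath u v) c :
  eqF (ulam v c \c tau_path (res_ob F) p c) (ulam u c).
Proof.
elim: p => [w|{}u w {}v s p IH] /=; first by rewrite cmpm1; apply: eqF_refl.
by rewrite cmpA; apply: eqF_trans (eqF_cmp _ IH) _; apply: ulam_step.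
Qed.

Lemma tau_path_res u v (p q : rpath u v) c :
  tau_path (res_ob F) p c = tau_path (res_ob F) q c.
Proof.
have lamE (r : rpath u v) :
    eqF (lamw F g v c \c tau_path (res_ob F) r c) (ulam u c).
  exact: eqF_trans (eqF_cmp _ (lamw_ulam _ _)) (ulam_path r c).
have [[e /bwdP/bwdP ->] [e' /bwdP/bwdP ->]] := (lamE p, lamE q).
by rewrite (eq_irrelevance e e').
Qed.

End PathIndependence.

Variable P : path_relation S.

Lemma Res_satisfies (F : action_cat M C) : satisfies P (Res F).
Proof. by move=> u v p q _ c; apply: tau_path_res. Qed.

Definition ResP : functor (action_cat M C) (paction_P_cat C P) :=
  @corestrict (paction_cat S C) (satisfies P) _ Res Res_satisfies.

End Restriction.

Definition coherent_presentation (M : monoidType) (S : presentation M)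
    (P : path_relation S) : Prop :=
  forall C : category, is_equivalence (ResP C P).
Arguments coherent_presentation {M} S P.

Section PresentedMonoid.
Variables (X : choiceType) (R : seq X -> seq X -> Prop).

Inductive ctx_closure : seq X -> seq X -> Prop :=
  CtxClosure w1 u v w2 of R u v : ctx_closure (w1 ++ u ++ w2) (w1 ++ v ++ w2).

Definition congruence : seq X -> seq X -> Prop :=
  clos_refl_sym_trans _ ctx_closure.

Lemma congruence_cat u u' v v' :
  congruence u u' -> congruence v v' -> congruence (u ++ v) (u' ++ v').
Proof.
move=> uu' vv'; apply: (@rst_trans _ _ _ (u' ++ v)).
  elim: uu' => {u u'} [_ _ [w1 a b w2 ab]|u|u w _|u w t _ ? _].
  - by apply: rst_step; rewrite -!catA; apply: CtxClosure.
  - exact: rst_refl.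
  - exact: rst_sym.
  - exact: rst_trans.
elim: vv' => {v v'} [_ _ [w1 a b w2 ab]|v|v w _|v w t _ ? _].
- by apply: rst_step; rewrite !(catA u'); apply: CtxClosure.
- exact: rst_refl.
- exact: rst_sym.
- exact: rst_trans.
Qed.

Definition congruenceb (u v : seq X) : bool := `[< congruence u v >].

Lemma congruenceb_equiv : equiv_class_of congruenceb.
Proof.
split=> [u|u v|v u w].
- by apply/asboolP; apply: rst_refl.
- by apply/asboolP/asboolP; apply: rst_sym.
- by move=> /asboolP uv /asboolP vw; apply/asboolP; apply: rst_trans uv vw.
Qed.

Canonical congruence_equiv := EquivRelPack congruenceb_equiv.

Definition presented_monoid := {eq_quot congruence_equiv}%qT.
HB.instance Definition _ := Choice.on presented_monoid.

Definition word_class (w : seq X) : presented_monoid :=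
  \pi_({eq_quot congruence_equiv})%qT w.

Lemma word_classP u v : word_class u = word_class v <-> congruence u v.
Proof. by split=> [/eqmodP/asboolP|uv] //; apply/eqmodP/asboolP. Qed.

Definition word_repr (a : presented_monoid) : seq X := repr a.

Lemma word_reprK a : word_class (word_repr a) = a.
Proof. exact: reprK. Qed.

Lemma word_classK w : congruence (word_repr (word_class w)) w.
Proof. by apply/word_classP; rewrite word_reprK. Qed.

Definition pm_mul (a b : presented_monoid) : presented_monoid :=
  word_class (word_repr a ++ word_repr b).
Definition pm_one : presented_monoid := word_class [::].

Lemma pm_mulE u v : pm_mul (word_class u) (word_class v) = word_class (u ++ v).
Proof. by apply/word_classP/congruence_cat; apply: word_classK. Qed.

Lemma pm_mulA : associative pm_mul.
Proof.
move=> a b c; rewrite -[a]word_reprK -[b]word_reprK -[c]word_reprK.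
by rewrite !pm_mulE catA.
Qed.

Lemma pm_mul1 : left_id pm_one pm_mul.
Proof. by move=> a; rewrite -[a]word_reprK pm_mulE. Qed.

Lemma pm_mulr1 : right_id pm_one pm_mul.
Proof. by move=> a; rewrite -[a]word_reprK pm_mulE cats0. Qed.

HB.instance Definition _ :=
  isMonoid.Build presented_monoid pm_mulA pm_mul1 pm_mulr1.

Lemma evalw_class w :
  evalw (fun x => word_class [:: x]) w = word_class w :> presented_monoid.
Proof.
case: w => // x w; elim: w x => //= y w IH x.
by rewrite IH; apply: pm_mulE.
Qed.

End PresentedMonoid.

Section Hecke.
Variable n : nat.
Local Notation word := (seq 'I_n).

(* The ordinal i of 'I_n stands for the generator T_(i+1). *)
Inductive hecke_rel : word -> word -> Prop :=
| HeckeIdem (i : 'I_n) : hecke_rel [:: i; i] [:: i]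
| HeckeBraid (i j : 'I_n) of j = i.+1 :> nat :
    hecke_rel [:: j; i; j] [:: i; j; i]
| HeckeComm (i j : 'I_n) of i + 2 <= j : hecke_rel [:: j; i] [:: i; j].

Definition hecke : monoidType := presented_monoid hecke_rel.

Definition consec (i j : 'I_n) : bool := j == i.+1 :> nat.
Definition far (s t : 'I_n) : bool := (s + 2 <= t) || (t + 2 <= s).

(* The set r''; [rb] takes the pair k' = k - 1, k. *)
Inductive hecke_rule : Type :=
| ra (i : 'I_n)
| rb (k' k : 'I_n) of consec k' k
| rc (s t : 'I_n) of far s t.

Definition hecke_lhs (r : hecke_rule) : word :=
  match r with
  | ra i => [:: i; i]
  | rb k' k _ => [:: k; k'; k]
  | rc s t _ => [:: s; t]
  end.

Definition hecke_rhs (r : hecke_rule) : word :=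
  match r with
  | ra i => [:: i]
  | rb k' k _ => [:: k'; k; k']
  | rc s t _ => [:: t; s]
  end.

(* Distinct rules have distinct pairs of sides, so [hecke_rule] is indeed the
   set of these pairs. *)
Lemma hecke_rule_inj : injective (fun r => (hecke_lhs r, hecke_rhs r)).
Proof.
case=> [i|k' k h|s t h] [i2|k2' k2 h2|s2 t2 h2] //= [].
- by move->.
- by move=> e e'; subst k2 k2'; rewrite (eq_irrelevance h h2).
- by move=> e e'; subst s2 t2; rewrite (eq_irrelevance h h2).
Qed.

Definition hecke_sys : rewriting_system :=
  @RewritingSystem 'I_n hecke_rule hecke_lhs hecke_rhs.

Definition heckeT (i : 'I_n) : hecke := word_class hecke_rel [:: i].

Lemma hecke_gen_surj (m : hecke) : exists w : word, evalw heckeT w = m.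
Proof. by exists (word_repr m); rewrite evalw_class word_reprK. Qed.

Lemma hecke_gen_eq (u v : word) : evalw heckeT u = evalw heckeT v <->
  clos_refl_sym_trans _ (fun u v => inhabited (@step hecke_sys u v)) u v.
Proof.
rewrite !evalw_class word_classP; split.
  elim=> {u v} [_ _ [w1 u v w2 uv]|u|u v _|u v w _ ? _].
  - apply: rst_step; case: uv => [i|i j ij|i j ij].
    + by split; apply: (@Step hecke_sys w1 (ra i) w2).
    + have h : consec i j by apply/eqP.
      by split; apply: (@Step hecke_sys w1 (rb h) w2).
    + have h : far j i by rewrite /far ij orbT.
      by split; apply: (@Step hecke_sys w1 (rc h) w2).
  - exact: rst_refl.
  - exact: rst_sym.
  - exact: rst_trans.
elim=> {u v} [_ _ [[w1 r w2]]|u|u v _|u v w _ ? _].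
- have [rel|rel] : hecke_rel (hecke_lhs r) (hecke_rhs r) \/
      hecke_rel (hecke_rhs r) (hecke_lhs r).
  + case: r => [i|i j /eqP ij|s t /orP[] h] /=.
    * by left; apply: HeckeIdem.
    * by left; apply: HeckeBraid.
    * by right; apply: HeckeComm.
    * by left; apply: HeckeComm.
  + exact/rst_step/CtxClosure.
  + exact/rst_sym/rst_step/CtxClosure.
- exact: rst_refl.
- exact: rst_sym.
- exact: rst_trans.
Qed.

Definition hecke_presentation : presentation hecke :=
  @Presentation hecke hecke_sys heckeT hecke_gen_surj hecke_gen_eq.

Local Notation "w1 *[ r ]* w2" := (@Step hecke_sys w1 r w2)
  (at level 30, format "w1  *[ r ]*  w2").
Local Notation "s ;; p" := (pcons s p) (at level 60, right associativity).

(* A step w1 r w2 is written [w1 *[r]* w2]; k1 is k + 1 and k' is k - 1. *)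
Inductive hecke_P : forall u v : word,
    @rpath hecke_sys u v -> @rpath hecke_sys u v -> Prop :=
| P1 s t (st : far s t) (ts : far t s) :
    @hecke_P [:: s; t] [:: s; t]
      ([::] *[rc st]* [::] ;; [::] *[rc ts]* [::] ;; pnil)
      pnil
| P2 k :
    @hecke_P [:: k; k; k] [:: k]
      ([:: k] *[ra k]* [::] ;; [::] *[ra k]* [::] ;; pnil)
      ([::] *[ra k]* [:: k] ;; [::] *[ra k]* [::] ;; pnil)
| P3 k' k (h : consec k' k) :
    @hecke_P [:: k; k'; k; k] [:: k'; k; k']
      ([:: k; k'] *[ra k]* [::] ;; [::] *[rb h]* [::] ;; pnil)
      ([::] *[rb h]* [:: k] ;; [:: k'] *[rb h]* [::] ;;
       [::] *[ra k']* [:: k; k'] ;; pnil)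
| P4 k' k (h : consec k' k) :
    @hecke_P [:: k; k; k'; k] [:: k'; k; k']
      ([:: k] *[rb h]* [::] ;; [::] *[rb h]* [:: k'] ;;
       [:: k'; k] *[ra k']* [::] ;; pnil)
      ([::] *[ra k]* [:: k'; k] ;; [::] *[rb h]* [::] ;; pnil)
| P5 s t (st : far s t) :
    @hecke_P [:: s; t; t] [:: t; s]
      ([:: s] *[ra t]* [::] ;; [::] *[rc st]* [::] ;; pnil)
      ([::] *[rc st]* [:: t] ;; [:: t] *[rc st]* [::] ;;
       [::] *[ra t]* [:: s] ;; pnil)
| P6 k' k (h : consec k' k) :
    @hecke_P [:: k; k'; k; k'; k] [:: k'; k; k']
      ([:: k; k'] *[rb h]* [::] ;; [:: k] *[ra k']* [:: k; k'] ;;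
       [::] *[rb h]* [:: k'] ;; [:: k'; k] *[ra k']* [::] ;; pnil)
      ([::] *[rb h]* [:: k'; k] ;; [:: k'; k] *[ra k']* [:: k] ;;
       [:: k'] *[rb h]* [::] ;; [::] *[ra k']* [:: k; k'] ;; pnil)
| P7 s' s t (h : consec s' s) (ts : far t s) (ts' : far t s') :
    @hecke_P [:: t; s; s'; s] [:: s'; s; s'; t]
      ([:: t] *[rb h]* [::] ;; [::] *[rc ts']* [:: s; s'] ;;
       [:: s'] *[rc ts]* [:: s'] ;; [:: s'; s] *[rc ts']* [::] ;; pnil)
      ([::] *[rc ts]* [:: s'; s] ;; [:: s] *[rc ts']* [:: s] ;;
       [:: s; s'] *[rc ts]* [::] ;; [::] *[rb h]* [:: t] ;; pnil)
| P8 i j k (ji : far j i) (ki : far k i) (kj : far k j) :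
    @hecke_P [:: k; j; i] [:: i; j; k]
      ([:: k] *[rc ji]* [::] ;; [::] *[rc ki]* [:: j] ;;
       [:: i] *[rc kj]* [::] ;; pnil)
      ([::] *[rc kj]* [:: i] ;; [:: j] *[rc ki]* [::] ;;
       [::] *[rc ji]* [:: k] ;; pnil)
| P9 k' k k1 (h : consec k' k) (h1 : consec k k1)
    (f : far k1 k') (f' : far k' k1) :
    @hecke_P [:: k1; k; k'; k1; k; k1] [:: k'; k; k'; k1; k; k']
      ([:: k1; k; k'] *[rb h1]* [::] ;; [:: k1] *[rb h]* [:: k1; k] ;;
       [::] *[rc f]* [:: k; k'; k1; k] ;; [:: k'; k1; k] *[rc f']* [:: k] ;;
       [:: k'] *[rb h1]* [:: k'; k] ;; [:: k'; k; k1] *[rb h]* [::] ;;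
       [:: k'; k] *[rc f]* [:: k; k'] ;; pnil)
      ([:: k1; k] *[rc f']* [:: k; k1] ;; [::] *[rb h1]* [:: k'; k; k1] ;;
       [:: k; k1] *[rb h]* [:: k1] ;; [:: k] *[rc f]* [:: k; k'; k1] ;;
       [:: k; k'; k1; k] *[rc f']* [::] ;; [:: k; k'] *[rb h1]* [:: k'] ;;
       [::] *[rb h]* [:: k1; k; k'] ;; pnil).

End Hecke.

(* Main.v *)
(* An element of the monoid is a product of runs of consecutive generators, one
   for each coset space Sigma_(k+1) / Sigma_k.  A letter multiplied to the left
   of a run extends it, or is absorbed by an idempotent rule, or slides through
   the run, possibly changing by one, and is then inserted into the next run.
   The rules give an isomorphism for each of these moves, and hence an
   isomorphism from F_w to F_(normal form of w) for every word w.  It is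
   compatible with every rewriting step: for a rule in front of a run, this is
   one of the nine families of relations, naturality, and the same statement for
   a rule in front of the next run.  So transformations composed of the tau_r
   depend on their end words only, and F_a := F_(chosen word for a) is an action
   that restricts to F.  That Res is fully faithful holds for any presentation. *)
From Stdlib Require Import Relation_Operators.
Require Import Defs.
From mathcomp Require Import all_boot zify.
From mathcomp Require Import boolp.

Set Implicit Arguments.
Unset Strict Implicit.
Unset Printing Implicit Defensive.
Local Open Scope cat_scope.

(** * Presentations of monoids *)

(** Equal normal forms reached in two ways give functors that are equal but not convertible, so the
    arrows into them cannot be compared directly. The presheaf [elt], X |-> sum over q of Hom(X, F_q
    c) with q ranging over codes of normal forms, absorbs this: inserting a letter x is an operation
    from its value at X to its value at F_x X, and a single equation of elements says that two
    insertions reach the same normal form and by the same arrow. If every rule acts on these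
    operations as restriction along tau_r, then so do the inverses, whiskerings and composites of
    the tau_r. Insertion that starts from the empty normal form yields split monomorphisms into
    normal forms, and these can be cancelled. The recursion rests on the fact that a letter sliding
    through the first run comes out as a letter other than T_n, so that the remaining runs and
    everything inserted into them involve T_1, ..., T_(n-1) only. *)

Lemma cmp_cancel (C : category) (x y z : C) (f : hom x y) (g : hom y x) :
  g \c f = idm x -> forall h : hom x z, h \c g \c f = h.
Proof. by move=> e h; rewrite -cmpA e cmpm1. Qed.

Lemma cmp_mono (C : category) (x y z : C) (f : hom y z) (g : hom z y) 
    (u v : hom x y) :
  g \c f = idm y -> f \c u = f \c v -> u = v.
Proof. by move=> e E; rewrite -[u]cmp1m -[v]cmp1m -e -!cmpA E. Qed.

Lemma cmp_epi (C : category) (x y z : C) (f : hom x y) (g : hom y x) 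
    (u v : hom y z) :
  f \c g = idm y -> u \c f = v \c f -> u = v.
Proof. by move=> e E; rewrite -[u]cmpm1 -[v]cmpm1 -e !cmpA E. Qed.

Lemma ff_eso_equivalence (C D : category) (F : functor C D) :
  (forall x y (h : hom (F x) (F y)), exists f, fmap F f = h) ->
  (forall x y (f f' : hom x y), fmap F f = fmap F f' -> f = f') ->
  (forall d : D, exists (c : C) (f : hom (F c) d) (g : hom d (F c)),
    g \c f = idm _ /\ f \c g = idm _) ->
  is_equivalence F.
Proof.
move=> full faith eso.
have [G0 {}eso] := choice eso.
pose f d := sval (cid (eso d)); pose g d := sval (cid (svalP (cid (eso d)))).
have gf d : g d \c f d = idm _ /\ f d \c g d = idm _.
  exact: (svalP (cid (svalP (cid (eso d))))).
have gK d : g d \c f d = idm _ by have [] := gf d.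
have fK d : f d \c g d = idm _ by have [] := gf d.
pose full' x y h := sval (cid (full x y h)).
have full'K x y (h : hom (F x) (F y)) : fmap F (full' x y h) = h.
  exact: (svalP (cid (full x y h))).
pose G1 d d' (h : hom d d') := full' _ _ (g d' \c (h \c f d)).
have G11 d : G1 d d (idm d) = idm (G0 d).
  by apply: faith; rewrite full'K fmap1 cmp1m gK.
have G1M x y z (k : hom y z) (h : hom x y) :
    G1 x z (k \c h) = G1 y z k \c G1 x y h.
  by apply: faith; rewrite fmapM !full'K -!cmpA (cmpA (f y)) fK cmp1m.
pose G : functor D C := @Functor D C G0 G1 G11 G1M.
exists G; split; split.
- pose a c : hom (G (F c)) c := full' _ _ (f (F c)).
  pose b c : hom c (G (F c)) := full' _ _ (g (F c)).
  have aN x y (h : hom x y) : fmap (fid C) h \c a x = a y \c fmap (fcomp G F) h.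
    by apply: faith; rewrite !fmapM /= !full'K cmpA fK cmp1m.
  have bN x y (h : hom x y) : fmap (fcomp G F) h \c b x = b y \c fmap (fid C) h.
    by apply: faith; rewrite !fmapM /= !full'K -!cmpA fK cmpm1.
  refine (@NatIso _ _ (fcomp G F) (fid C)
    (@NatTrans _ _ (fcomp G F) (fid C) a aN)
    (@NatTrans _ _ (fid C) (fcomp G F) b bN) _ _) => x /=.
    by apply: faith; rewrite !fmapM !full'K fmap1 gK.
  by apply: faith; rewrite !fmapM !full'K fmap1 fK.
- have aN x y (h : hom x y) : fmap (fid D) h \c f x = f y \c fmap (fcomp F G) h.
    by rewrite /= full'K cmpA fK cmp1m.
  have bN x y (h : hom x y) : fmap (fcomp F G) h \c g x = g y \c fmap (fid D) h.
    by rewrite /= full'K -!cmpA fK cmpm1.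
  exact: (@NatIso _ _ (fcomp F G) (fid D)
    (@NatTrans _ _ (fcomp F G) (fid D) f aN)
    (@NatTrans _ _ (fid D) (fcomp F G) g bN) gK fK).
Qed.

(** Proofs of equality are unique by proof irrelevance, whatever the type of the index. This is used
    for sums over [M] and over normal forms. *)
Lemma existT_inj (A : Type) (P : A -> Type) a (x y : P a) :
  existT P a x = existT P a y -> x = y.
Proof.
move=> E; have := projT2_eq E.
by rewrite /= (Prop_irrelevance (projT1_eq E) erefl).
Qed.

(** * Canonical transformations and their separation by a presheaf *)

Section CanonicalTransformations.
Variables (S : rewriting_system) (C : category) (F : paction S C).
Local Notation W := (wordF F).

Inductive canonical : forall u v, nat_trans (W u) (W v) -> Prop :=
| can_id u : canonical (u := u) (v := u) (nt_id (W u))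
| can_comp u v w (g : nat_trans (W v) (W w)) (f : nat_trans (W u) (W v)) :
    canonical g -> canonical f -> canonical (u := u) (v := w) (nt_comp g f)
| can_rule r : canonical (u := lhs r) (v := rhs r) (pact_tau F r)
| can_rule_inv r : canonical (u := rhs r) (v := lhs r) (bwd (pact_tau F r))
| can_cons x u v (f : nat_trans (W u) (W v)) :
    canonical f -> canonical (u := x :: u) (v := x :: v) (nt_whiskl (F x) f)
| can_whiskr u v w (f : nat_trans (W u) (W v)) : canonical f ->
    canonical (u := u ++ w) (v := v ++ w)
      (nt_comp (bwd (word_cat F v w))
        (nt_comp (nt_whiskr f (W w)) (word_cat F u w)))
| can_ext u v (f g : nat_trans (W u) (W v)) :
    (forall c, f c = g c) -> canonical f -> canonical g.

(** Stated for one component: composites of functors that are bracketed differently have convertible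
    values without being convertible functors. *)
Definition canon u v c (h : hom (W u c) (W v c)) : Prop :=
  exists2 f : nat_trans (W u) (W v), canonical f & f c = h.

Lemma canon_id u c : canon (u := u) (v := u) (idm (W u c)).
Proof. by exists (nt_id (W u)); first exact: can_id. Qed.

Lemma canon_comp u v w c (g : hom (W v c) (W w c)) (f : hom (W u c) (W v c)) :
  canon g -> canon f -> canon (u := u) (v := w) (g \c f).
Proof.
by move=> [g' cg <-] [f' cf <-]; exists (nt_comp g' f'); first exact: can_comp.
Qed.

Lemma canon_cons x u v c (f : hom (W u c) (W v c)) :
  canon f -> canon (u := x :: u) (v := x :: v) (fmap (F x) f).
Proof.
by move=> [f' cf <-]; exists (nt_whiskl (F x) f'); first exact: can_cons.
Qed.

Lemma canon_whiskr u v w c (f : hom (W u (W w c)) (W v (W w c))) :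
  canon f ->
  canon (u := u ++ w) (v := v ++ w)
    (bwd (word_cat F v w) c \c (f \c word_cat F u w c)).
Proof. by move=> [f' cf <-]; eexists; first exact: can_whiskr cf. Qed.

Lemma canon_whiskl w u v c (f : hom (W u c) (W v c)) :
  canon f ->
  canon (u := w ++ u) (v := w ++ v)
    (bwd (word_cat F w v) c \c (fmap (W w) f \c word_cat F w u c)).
Proof.
move=> cf; elim: w => [|x w /canon_cons IH] /=; first by rewrite cmpm1 cmp1m.
by move: (IH x); rewrite !fmapM !cmpm1 !cmp1m.
Qed.

(** No inverse law is imposed. Once parallel canonical transformations agree, both composites are
    canonical endomorphisms and hence identities. *)
Definition canonical_pair u v : Prop :=
  exists (f : nat_trans (W u) (W v)) (g : nat_trans (W v) (W u)),
    canonical f /\ canonical g.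

Lemma can_whiskl w u v (f : nat_trans (W u) (W v)) : canonical f ->
  canonical (u := w ++ u) (v := w ++ v)
    (nt_comp (bwd (word_cat F w v))
      (nt_comp (nt_whiskl (W w) f) (word_cat F w u))).
Proof.
move=> cf; elim: w => [|x w /can_cons IH] /=.
  by apply: can_ext cf => c /=; rewrite cmpm1 cmp1m.
by apply: can_ext (IH x) => c /=; rewrite !fmapM !cmpm1 !cmp1m.
Qed.

Lemma canonical_pair_zigzag u v :
  clos_refl_sym_trans _ (fun u v => inhabited (@step S u v)) u v ->
  canonical_pair u v.
Proof.
elim=> {u v} [_ _ [[w1 r w2]]|u|u v _ [f [g [cf cg]]]
  |u v w _ [f [g [cf cg]]] _ [f' [g' [cf' cg']]]].
- do 2!eexists; split; apply/can_whiskl/can_whiskr; first exact: can_rule.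
  exact: can_rule_inv.
- by exists (nt_id _), (nt_id _); split; apply: can_id.
- by exists g, f.
- by exists (nt_comp f' f), (nt_comp g g'); split; apply: can_comp.
Qed.

Lemma canon_word_cat0 w c :
  canon (u := w ++ [::]) (v := w) (word_cat F w [::] c).
Proof.
elim: w => [|x w IH] /=; first exact: canon_id.
by rewrite cmp1m; apply: canon_cons.
Qed.

(** The two bracketings of the word are equal but not convertible; the canonical [k] stands in for
    the transport between them. *)
Lemma word_catA u v w c :
  exists2 k, canon (u := (u ++ v) ++ w) (v := u ++ (v ++ w)) k &
    word_cat F u v (W w c) \c word_cat F (u ++ v) w c =
    fmap (W u) (word_cat F v w c) \c (word_cat F u (v ++ w) c \c k).
Proof.
elim: u => [|x u [k ck E]] /=.
  by exists (idm _); [apply: canon_id | rewrite !cmp1m cmpm1].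
exists (fmap (F x) k); first exact: canon_cons.
by rewrite !cmp1m -!fmapM E.
Qed.

(* A presheaf [T] with an operation for each letter, on which every rule acts as
   restriction along its [pact_tau], detects canonical transformations. *)
Section Uniqueness.
Variables (c : C) (T : C -> Type).
Variables (pr : forall X Y, hom Y X -> T X -> T Y).
Variables (op : forall x X, T X -> T (F x X)).
Variables (mono : forall X, T X -> Prop).
Hypothesis pr1 : forall X p, pr (idm X) p = p.
Hypothesis prM : forall X Y Z (h : hom Y X) (k : hom Z Y) p,
  pr k (pr h p) = pr (h \c k) p.
Hypothesis opN : forall x X Y (h : hom Y X) p,
  op x (pr h p) = pr (fmap (F x) h) (op x p).

Fixpoint opw w X (p : T X) : T (W w X) :=
  if w is x :: w' then op x (opw w' p) else p.

Hypothesis op_rule : forall r X (p : T X),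
  opw (lhs r) p = pr (pact_tau F r X) (opw (rhs r) p).
Hypothesis mono_op : forall x X (p : T X), mono p -> mono (op x p).
Hypothesis monoP : forall X Y (p : T X) (h k : hom Y X), mono p ->
  pr h p = pr k p -> h = k.
Variable p0 : T c.
Hypothesis mono0 : mono p0.

Lemma opw_cat u w X (p : T X) :
  opw (u ++ w) p = pr (word_cat F u w X) (opw u (opw w p)).
Proof.
elim: u => [|x u IH] /=; first by rewrite pr1.
by rewrite IH opN cmp1m.
Qed.

Lemma opw_canonical u v (f : nat_trans (W u) (W v)) : canonical f ->
  forall X (p : T X), opw u p = pr (f X) (opw v p).
Proof.
elim=> {u v f} [u|u v w g f _ IHg _ IHf|r|r|x u v f _ IH|u v w f _ IH
  |u v f g E _ IH] X p /=.
- by rewrite pr1.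
- by rewrite IHf IHg prM.
- exact: op_rule.
- by rewrite op_rule prM bwdK pr1.
- by rewrite IH opN.
- rewrite !opw_cat IH !prM; congr (pr _ _).
  have /= K := bwdK (word_cat F v w) X.
  by rewrite !cmpA K cmp1m.
- by rewrite -E IH.
Qed.

(** Both [f] and [g] restrict [opw v p0] to [opw u p0], and [opw v p0] inherits from [p0] the
    property that lets arrows be cancelled. *)
Lemma canonical_unique u v (f g : nat_trans (W u) (W v)) :
  canonical f -> canonical g -> f c = g c.
Proof.
move=> cf cg; apply: (@monoP _ _ (opw v p0)).
  by elim: v {f g cf cg} => //= x v IH; apply: mono_op.
by rewrite -!opw_canonical.
Qed.

End Uniqueness.
End CanonicalTransformations.

Section Evaluation.
Variables (M : monoidType) (X : Type) (g : X -> M).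
Local Open Scope group_scope.

Lemma evalw_cons x w : evalw g (x :: w) = g x * evalw g w.
Proof. by case: w => [|y w] //=; rewrite mulg1. Qed.

Lemma evalw_cat u v : evalw g (u ++ v) = evalw g u * evalw g v.
Proof.
by elim: u => [|x u IH]; rewrite ?mul1g // cat_cons !evalw_cons IH mulgA.
Qed.

End Evaluation.

(** * Essential surjectivity from uniqueness of canonical transformations *)

Section EssentialSurjectivity.
Variables (M : monoidType) (S : presentation M) (C : category) (F : paction S C).
Local Notation W := (wordF F).
Local Notation g := (@gen M S).
Local Open Scope group_scope.

Hypothesis unique : forall u v (f f' : nat_trans (W u) (W v)),
  canonical f -> canonical f' -> forall c, f c = f' c.

Lemma canon_unique u v c (h h' : hom (W u c) (W v c)) :
  canon h -> canon h' -> h = h'.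
Proof. by move=> [f cf <-] [f' cf' <-]; apply: unique. Qed.

(** A zigzag of steps is only known to exist, so the isomorphism is extracted by choice; [unique]
    makes the choice immaterial. *)
Lemma canonical_iso u v : evalw g u = evalw g v ->
  {k : nat_iso (W u) (W v) | canonical k}.
Proof.
move=> e; have P := canonical_pair_zigzag F (proj1 (Defs.gen_eq u v) e).
have [f /cid[f' [cf cf']]] := cid P.
have fK c : f' c \c f c = idm _.
  by apply: canon_unique (canon_id _ _ _); apply: canon_comp;
    [exists f' | exists f].
have f'K c : f c \c f' c = idm _.
  by apply: canon_unique (canon_id _ _ _); apply: canon_comp;
    [exists f | exists f'].
by exists (NatIso fK f'K).
Qed.

Definition canon_map u v (e : evalw g u = evalw g v) : nat_iso (W u) (W v) :=
  sval (canonical_iso e).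

Lemma canon_map_canon u v (e : evalw g u = evalw g v) c : canon (canon_map e c).
Proof. by exists (canon_map e) => //; apply: (svalP (canonical_iso e)). Qed.

Lemma canon_map_inv u v (e : evalw g u = evalw g v) c :
  canon (bwd (canon_map e) c).
Proof.
have -> : bwd (canon_map e) c = canon_map (esym e) c.
  rewrite -[LHS]cmp1m (_ : idm _ = canon_map (esym e) c \c canon_map e c).
    by rewrite -cmpA bwdK cmpm1.
  apply: canon_unique (canon_id _ _ _) _.
  by apply: canon_comp; apply: canon_map_canon.
exact: canon_map_canon.
Qed.

Definition nf (m : M) : seq (letter S) := sval (cid (gen_surj S m)).

Lemma evalw_nf m : evalw g (nf m) = m.
Proof. exact: (svalP (cid (gen_surj S m))). Qed.

Lemma evalw_nf_cat a b : evalw g (nf a ++ nf b) = evalw g (nf (a * b)).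
Proof. by rewrite evalw_cat !evalw_nf. Qed.

Definition nf_act (m : M) : functor C C := W (nf m).

Definition nf_eta : nat_iso (nf_act 1) (fid C) :=
  @canon_map (nf 1) [::] (evalw_nf 1).

Definition nf_lam a b :
    nat_iso (fcomp (nf_act a) (nf_act b)) (nf_act (a * b)) :=
  ni_comp (canon_map (evalw_nf_cat a b)) (ni_sym (word_cat F (nf a) (nf b))).

Lemma canon_fam_eq a b (e : a = b) c :
  canon (u := nf a) (v := nf b) (fam_eq nf_act e c).
Proof. by case: b / e; apply: canon_id. Qed.

Lemma nf_lamA a b c x :
  nf_lam (a * b) c x \c nf_lam a b (nf_act c x) =
  fam_eq nf_act (mulgA a b c) x \c
    (nf_lam a (b * c) x \c fmap (nf_act a) (nf_lam b c x)).
Proof.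
have [k ck] := word_catA F (nf a) (nf b) (nf c) x.
set p := word_cat F (nf a) (nf b) _.
set q := word_cat F (nf a ++ nf b) (nf c) x => E.
have /= qK := bwdK (word_cat F (nf a ++ nf b) (nf c)) x.
have /= pK := bwdK (word_cat F (nf a) (nf b)) (W (nf c) x).
have /= pK' := fwdK (word_cat F (nf a) (nf b)) (W (nf c) x).
have /= rK := fwdK (word_cat F (nf b) (nf c)) x.
(* Precomposed with [p] and [q], both sides start at the single word [(nf a ++ nf b) ++ nf c], where
   uniqueness applies. *)
apply: (cmp_epi pK); apply: (cmp_epi qK).
transitivity (canon_map (evalw_nf_cat (a * b) c) x \c
    (bwd (word_cat F (nf (a * b)) (nf c)) x \c
      (canon_map (evalw_nf_cat a b) (W (nf c) x) \c q))).
  by rewrite -!cmpA -/p (cmpA _ p) pK' cmp1m.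
transitivity (fam_eq nf_act (mulgA a b c) x \c
    (canon_map (evalw_nf_cat a (b * c)) x \c
      ((bwd (word_cat F (nf a) (nf (b * c))) x \c
        (fmap (W (nf a)) (canon_map (evalw_nf_cat b c) x) \c
          word_cat F (nf a) (nf b ++ nf c) x)) \c k))).
  apply: canon_unique.
    apply: canon_comp (canon_map_canon _ _) _.
    exact: canon_whiskr (canon_map_canon _ _).
  apply: canon_comp (canon_fam_eq _ _) _.
  apply: canon_comp (canon_map_canon _ _) _.
  apply: canon_comp _ ck.
  exact: canon_whiskl (canon_map_canon _ _).
rewrite -!cmpA -/p -/q E fmapM.
by rewrite -!cmpA (cmpA _ (fmap _ (word_cat _ _ _ _))) -fmapM rK fmap1 cmp1m.
Qed.

Lemma nf_lam1g a x :
  fam_eq nf_act (mul1g a) x \c nf_lam 1 a x = nf_eta (nf_act a x).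
Proof.
have /= pK := bwdK (word_cat F (nf 1) (nf a)) x.
have /= pK' := fwdK (word_cat F (nf 1) (nf a)) x.
apply: (cmp_epi pK); rewrite -!cmpA pK' cmpm1.
apply: canon_unique.
  exact: canon_comp (canon_fam_eq _ _) (canon_map_canon _ _).
have := canon_whiskr
  (canon_map_canon (evalw_nf 1 : _ = evalw g [::]) (W (nf a) x)).
by rewrite /= cmp1m.
Qed.

Lemma nf_lamg1 a x :
  fam_eq nf_act (mulg1 a) x \c nf_lam a 1 x = fmap (nf_act a) (nf_eta x).
Proof.
have /= pK := bwdK (word_cat F (nf a) (nf 1)) x.
have /= pK' := fwdK (word_cat F (nf a) (nf 1)) x.
apply: (cmp_epi pK); rewrite -!cmpA pK' cmpm1.
apply: canon_unique.
  exact: canon_comp (canon_fam_eq _ _) (canon_map_canon _ _).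
have := canon_whiskl (nf a) (canon_map_canon (evalw_nf 1 : _ = evalw g [::]) x).
have /= qK := bwdK (word_cat F (nf a) [::]) x.
move=> /(canon_comp (canon_word_cat0 F (nf a) x)).
by rewrite /= cmpA qK cmp1m.
Qed.

Definition nf_action : action M C := Action nf_lamA nf_lam1g nf_lamg1.

Definition to_letter x : nat_iso (nf_action (g x)) (F x) :=
  ni_comp (ni_unitr (F x)) (canon_map (evalw_nf (g x) : _ = evalw g [:: x])).

Lemma cmp_insert (x y z t u : C) (l : hom z u) (k : hom y z) (b : hom t y)
    (f : hom y t) (h : hom x z) (h' : hom x y) :
  b \c f = idm y -> h = k \c h' ->
  l \c h = l \c (k \c b) \c ((idm t \c f) \c h').
Proof. by move=> K ->; rewrite cmp1m !cmpA -(cmpA _ b) K cmpm1. Qed.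

(** The factors of lambda for [nf_action] are canonical maps of [F], so that, once the letters are
    replaced through [to_letter], lambda is a single canonical map out of [w]. This makes the
    restricted tau_r comparable with the given one. *)
Lemma lamw_to_letter w c :
  exists2 k, canon (u := w) (v := nf (evalw g w)) k &
    lamw nf_action g w c = k \c wordN to_letter w c.
Proof.
case: w => [|x w].
  by exists (bwd nf_eta c); [apply: canon_map_inv | rewrite /= cmpm1].
elim: w x => [|y w IH] x.
  exists (bwd (canon_map (evalw_nf (g x) : _ = evalw g [:: x])) c).
    exact: canon_map_inv.
  rewrite /= fmap1 cmp1m cmpm1.
  exact: (esym (fwdK (canon_map (evalw_nf (g x) : _ = evalw g [:: x])) c)).
have [k ck E] := IH y.
pose w' := y :: w.
pose e : evalw g (nf (g x)) = evalw g [:: x] := evalw_nf (g x).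
exists (nf_lam (g x) (evalw g w') c \c
    (fmap (nf_act (g x)) k \c bwd (canon_map e) (W w' c))).
  have /= pK := bwdK (word_cat F (nf (g x)) w') c.
  have c1 := canon_whiskl (nf (g x)) ck.
  have c2 := canon_whiskr (canon_map_inv e (W w' c)).
  have := canon_comp (canon_map_canon (evalw_nf_cat (g x) (evalw g w')) c)
    (canon_comp c1 c2).
  rewrite /= fmap1 !cmpm1 !cmpA.
  rewrite -[_ \c word_cat F (nf (g x)) _ c \c _]cmpA pK cmpm1.
  exact.
apply: cmp_insert (fwdK (canon_map e) (W w' c)) _.
exact: etrans (congr1 (fmap (nf_act (g x))) E) (fmapM _ _ _).
Qed.

Lemma to_letter_rule r c :
  wordN to_letter (rhs r) c \c pact_tau (res_ob S nf_action) r c =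
  pact_tau F r c \c wordN to_letter (lhs r) c.
Proof.
have [k ck E] := lamw_to_letter (lhs r) c.
have [l cl E'] := lamw_to_letter (rhs r) c.
have [l' cl'] : exists2 l', canon l' & l' \c l = idm _.
  have e : evalw g (nf (evalw g (rhs r))) = evalw g (rhs r) by rewrite evalw_nf.
  exists (canon_map e c); first exact: canon_map_canon.
  by apply: canon_unique (canon_comp (canon_map_canon _ _) cl) (canon_id _ _ _).
have /= K := bwdK (lamw nf_action g (rhs r)) c.
move=> lK; apply: (cmp_mono lK).
rewrite /= !cmpA -E' K cmp1m E cmpA; congr (_ \c _).
apply: canon_unique.
  exact: canon_comp (canon_fam_eq _ _) ck.
apply: canon_comp cl _.
by exists (pact_tau F r) => //; apply: can_rule.
Qed.

Lemma from_letter_rule r c :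
  wordN (fun x => bwd (to_letter x)) (rhs r) c \c pact_tau F r c =
  pact_tau (res_ob S nf_action) r c \c
    wordN (fun x => bwd (to_letter x)) (lhs r) c.
Proof.
have toK w :
    wordN to_letter w c \c wordN (fun x => bwd (to_letter x)) w c = idm _.
  rewrite -wordN_comp -[RHS](wordN_id F).
  apply: (congr1 (fun s : forall x, nat_trans (F x) (F x) => wordN s w c)).
  apply: functional_extensionality_dep => x; apply: nat_trans_ext => d.
  exact: bwdK.
have fromK w :
    wordN (fun x => bwd (to_letter x)) w c \c wordN to_letter w c = idm _.
  rewrite -wordN_comp -[RHS](wordN_id (res_ob S nf_action)).
  apply: (congr1
    (fun s : forall x, nat_trans (nf_action (g x)) (nf_action (g x)) =>
      wordN s w c)).
  apply: functional_extensionality_dep => x; apply: nat_trans_ext => d.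
  exact: fwdK.
apply: (cmp_mono (fromK _)); transitivity (pact_tau F r c).
  by rewrite cmpA toK cmp1m.
rewrite cmpA; apply: esym.
apply: etrans (congr1 (fun z => z \c _) (to_letter_rule r c)) _.
by rewrite -cmpA toK cmpm1.
Qed.

Definition to_letters : paction_mor (res_ob S nf_action) F :=
  @PActionMor S C (res_ob S nf_action) F (fun x => to_letter x)
    to_letter_rule.

Definition from_letters : paction_mor F (res_ob S nf_action) :=
  @PActionMor S C F (res_ob S nf_action) (fun x => bwd (to_letter x))
    from_letter_rule.

Lemma from_to_letters : pmor_comp from_letters to_letters = pmor_id _.
Proof. by apply: paction_mor_ext => x c; apply: (fwdK (to_letter x) c). Qed.

Lemma to_from_letters : pmor_comp to_letters from_letters = pmor_id _.
Proof. by apply: paction_mor_ext => x c; apply: (bwdK (to_letter x) c). Qed.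

End EssentialSurjectivity.

(** * Full faithfulness of restriction *)

Section FullyFaithful.
Variables (M : monoidType) (S : presentation M) (C : category).
Local Notation g := (@gen M S).
Local Open Scope group_scope.

(** Every element is the value of a word [w], and lambda_w is invertible, so naturality of lambda_w
    forces the component there. *)
Lemma res_mor_faithful (A B : action M C) (r s : action_mor A B) :
  res_mor S r = res_mor S s -> r = s.
Proof.
move=> E; apply: action_mor_ext => a x.
have [w e] := gen_surj S a; case: a / e.
apply: (cmp_epi (bwdK (lamw A g w) x)).
have /= <- := lamw_nat (S := S) r w x; have /= <- := lamw_nat (S := S) s w x.
have Ew : (fun y => r (g y)) = (fun y => s (g y)).
  by have := congr1 (fun t : paction_mor _ _ => pmor t) E.
by rewrite Ew.
Qed.

Lemma lamw_cat (A : action M C) u v c :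
  eqF (lamw A g (u ++ v) c)
    (act_lam A (evalw g u) (evalw g v) c \c
      (lamw A g u (A (evalw g v) c) \c
        (fmap (wordF (fun x => A (g x)) u) (lamw A g v c) \c
          word_cat (fun x => A (g x)) u v c))).
Proof.
apply: eqF_trans (lamw_ulam _ _ _) _; apply: eqF_trans (ulam_cat _ _ _ _) _.
apply: eqF_trans (eqF_laml (eqF_cmp _ (eqF_sym (lamw_ulam A u _)))) _.
exact: eqF_lamr (eqF_sym (lamw_ulam A v c)).
Qed.

Lemma lamw_step (A : action M C) u v (s : step u v) c :
  eqF (lamw A g v c \c tau_step (res_ob S A) s c) (lamw A g u c).
Proof.
apply: eqF_trans (eqF_cmp _ (lamw_ulam _ _ _)) _.
apply: eqF_trans (ulam_step _ _ _) _.
exact: eqF_sym (lamw_ulam _ _ _).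
Qed.

Section WordNat.
Variables (X : Type) (F G : X -> functor C C).
Variable rho : forall x, nat_trans (F x) (G x).

Lemma wordN_cat u w c :
  word_cat G u w c \c wordN rho (u ++ w) c =
  wordN rho u (wordF G w c) \c fmap (wordF F u) (wordN rho w c) \c
    word_cat F u w c.
Proof.
elim: u => [|x u IH] /=; first by rewrite !cmp1m cmpm1.
rewrite !cmp1m !cmpA (ntN (rho x)) -!cmpA -fmapM.
by rewrite IH !fmapM !cmpA.
Qed.

Lemma wordN_catV u w c :
  wordN rho (u ++ w) c \c bwd (word_cat F u w) c =
  bwd (word_cat G u w) c \c
    (wordN rho u (wordF G w c) \c fmap (wordF F u) (wordN rho w c)).
Proof.
apply/bwdP; rewrite cmpA wordN_cat -!cmpA.
by have /= -> := bwdK (word_cat F u w) c; rewrite cmpm1.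
Qed.

End WordNat.

Lemma pmor_step (F G : paction S C) (rho : paction_mor F G) u v
    (s : step u v) c :
  wordN rho v c \c tau_step F s c = tau_step G s c \c wordN rho u c.
Proof.
case: s => w1 r w2 /=.
rewrite !cmpA wordN_catV -!cmpA wordN_cat; congr (_ \c _).
rewrite [in RHS]cmpA [in RHS](cmpA (fmap _ _)).
rewrite (ntN (wordN rho w1)) -!cmpA; congr (_ \c _).
rewrite !cmpA -!fmapM; congr (fmap _ _ \c _).
rewrite !cmpA wordN_catV -!cmpA wordN_cat; congr (_ \c _).
rewrite !cmpA; congr (_ \c _).
rewrite -(pmor_tau rho) -!cmpA; congr (_ \c _).
exact: (ntN (pact_tau F r)).
Qed.

(** The diagram behind [conj_word_cat], with abstract arrows because the squares used there fit
    together only up to conversion. *)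
Lemma paste_squares (x0 x1 x2 x3 x4 x5 x6 x7 x8 : C)
    (a : hom x2 x3) (b : hom x1 x2) (w : hom x0 x1) (n : hom x4 x0)
    (w' : hom x4 x5) (p : hom x5 x6) (m : hom x6 x1) (m' : hom x7 x2)
    (b' : hom x6 x7) (cu : hom x8 x3) (a' : hom x7 x8)
    (y z : C) (fl : hom x5 y) (fc : hom y x7) (a2 : hom y z) (fc' : hom z x8) :
  w \c n = m \c p \c w' -> b \c m = m' \c b' -> cu \c a' = a \c m' ->
  fc' \c a2 = a' \c fc -> fc \c fl = b' \c p ->
  a \c (b \c w) \c n = cu \c fc' \c (a2 \c (fl \c w')).
Proof.
move=> E1 E2 E3 E4 E5; rewrite -!cmpA E1 !cmpA -(cmpA cu) E4 cmpA E3.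
by rewrite -(cmpA _ fc) E5 -!cmpA (cmpA b) E2 -!cmpA.
Qed.

Section Fullness.
Variables (A B : action M C) (rho : paction_mor (res_ob S A) (res_ob S B)).

(** The only possible value of an extension of [rho] at the value of [w]: the equation [lamw_nat]
    solved for it. *)
Definition conj_word w : nat_trans (A (evalw g w)) (B (evalw g w)) :=
  nt_comp (lamw B g w) (nt_comp (wordN rho w) (bwd (lamw A g w))).

Lemma conj_wordE w c :
  conj_word w c \c lamw A g w c = lamw B g w c \c wordN rho w c.
Proof.
rewrite /= -!cmpA; congr (_ \c _).
by have /= -> := fwdK (lamw A g w) c; rewrite cmpm1.
Qed.

(** Pairing with the element of [M] lets the transformations of two words be equated without
    transport along the equality of their values. *)
Definition at_value w : {m : M & nat_trans (A m) (B m)} :=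
  existT _ (evalw g w) (conj_word w).

Lemma fam_eq_existT a b (e : a = b) (p : nat_trans (A a) (B a))
    (q : nat_trans (A b) (B b)) :
  (forall c, fam_eq B e c \c p c = q c \c fam_eq A e c) ->
  existT (fun m => nat_trans (A m) (B m)) a p = existT _ b q.
Proof.
case: b / e q => q E; congr (existT _ _ _); apply: nat_trans_ext => c.
by have := E c; rewrite /= cmpm1 cmp1m.
Qed.

(** In [A] and in [B], lambda_v after tau_s is lambda_u, and [rho] commutes with tau_s; so
    conjugation by lambda gives the same result at both ends. *)
Lemma at_value_step u v (s : step u v) : at_value u = at_value v.
Proof.
apply: esym; apply: (@fam_eq_existT _ _ (esym (gen_step s))) => c.
have [eA EA] := lamw_step A s c; have [eB EB] := lamw_step B s c.
rewrite (Prop_irrelevance eB eA) in EB.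
rewrite (Prop_irrelevance (esym (gen_step s)) eA).
apply: (@cmp_epi _ _ _ _ (lamw A g v c \c tau_step (res_ob S A) s c)
  (bwd (lamw A g u) c \c fam_eq A eA c)).
  apply: (cmp_mono (fwdK (fam_eq A eA) c)).
  rewrite -!cmpA (cmpA (lamw A g v c)) (cmpA (fam_eq A eA c)) EA cmpm1.
  by have /= K := bwdK (lamw A g u) c; rewrite cmpA K cmp1m.
rewrite -[in RHS]cmpA EA conj_wordE -EB -!cmpA; congr (_ \c _).
congr (_ \c _).
have /= K := fwdK (lamw A g v) c.
by rewrite (cmpA (bwd _ c)) K cmp1m; apply: (pmor_step rho s c).
Qed.

Lemma at_value_eq u v : evalw g u = evalw g v -> at_value u = at_value v.
Proof.
move=> /Defs.gen_eq; elim=> {u v} [u v [s]|//|u v _ ->//|u v w _ -> _ //].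
exact: at_value_step.
Qed.

(** The specification covers all words of value [m], so [extendE] is available for every word and
    not only for a chosen one. *)
Lemma conj_value m : {p : nat_trans (A m) (B m) |
  forall w, evalw g w = m -> at_value w = existT _ m p}.
Proof.
have [w e] := cid (gen_surj S m); case: m / e.
by exists (conj_word w) => v e; apply: at_value_eq.
Qed.

Definition extend m := sval (conj_value m).

Lemma extendE w : extend (evalw g w) = conj_word w.
Proof. exact: (esym (existT_inj (svalP (conj_value (evalw g w)) w erefl))). Qed.

Lemma existT_fam_eq a b (e : a = b) (p : nat_trans (A a) (B a))
    (q : nat_trans (A b) (B b)) c :
  existT (fun m => nat_trans (A m) (B m)) a p = existT _ b q ->
  fam_eq B e c \c p c = q c \c fam_eq A e c.
Proof.
by case: b / e q => q E; rewrite (existT_inj E) /= cmp1m cmpm1.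
Qed.

Lemma conj_word_cat u v x :
  lamw B g u (B (evalw g v) x) \c
    (fmap (wordF (fun y => B (g y)) u) (lamw B g v x) \c
      word_cat (fun y => B (g y)) u v x) \c wordN rho (u ++ v) x =
  nt_hcomp (conj_word u) (conj_word v) x \c
    (lamw A g u (A (evalw g v) x) \c
      (fmap (wordF (fun y => A (g y)) u) (lamw A g v x) \c
        word_cat (fun y => A (g y)) u v x)).
Proof.
have Nl := ntN (lamw A g u) (conj_word v x).
pose WA := wordF (fun y => A (g y)) u.
have E : fmap WA (conj_word v x) \c fmap WA (lamw A g v x) =
    fmap WA (lamw B g v x) \c fmap WA (wordN rho v x).
  exact: etrans (esym (fmapM _ _ _))
    (etrans (congr1 (fmap WA) (conj_wordE v x)) (fmapM _ _ _)).
exact: paste_squares (wordN_cat rho u v x) (ntN (wordN rho u) (lamw B g v x))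
  (conj_wordE u (B (evalw g v) x)) Nl E.
Qed.

Lemma extend_lam a b x :
  extend (a * b) x \c act_lam A a b x =
  act_lam B a b x \c nt_hcomp (extend a) (extend b) x.
Proof.
have [u eu] := gen_surj S a; have [v ev] := gen_surj S b.
case: a / eu; case: b / ev; rewrite !extendE.
have [eA EA] := lamw_cat A u v x; have [eB EB] := lamw_cat B u v x.
rewrite (Prop_irrelevance eB eA) in EB.
have E := existT_fam_eq eA x (svalP (conj_value (evalw g u * evalw g v)) _ eA).
move: EA EB (conj_word_cat u v x).
set RA := lamw A g u _ \c _; set RB := lamw B g u _ \c _ => EA EB ER.
have [r rK] : exists r, RA \c r = idm _.
  pose WA := wordF (fun y => A (g y)) u.
  exists (bwd (word_cat (fun y => A (g y)) u v) x \c
    (fmap WA (bwd (lamw A g v) x) \c bwd (lamw A g u) (A (evalw g v) x))).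
  have /= K := bwdK (word_cat (fun y => A (g y)) u v) x.
  have /= K' := congr1 (fmap WA) (bwdK (lamw A g v) x).
  have /= K'' := bwdK (lamw A g u) (A (evalw g v) x).
  rewrite /RA -!cmpA (cmpA (word_cat _ _ _ _)) K cmp1m.
  by rewrite (cmpA (fmap _ _)) -fmapM K' fmap1 cmp1m.
apply: (cmp_epi rK); rewrite -[in LHS](cmpA (extend _ x)) -EA.
rewrite [in LHS](cmpA (extend _ x)) -E -(cmpA _ (conj_word _ x)) conj_wordE.
by rewrite (cmpA (fam_eq _ _ _)) EB -!(cmpA (act_lam B _ _ _)) ER.
Qed.

Lemma extend_eta x : act_eta B x \c extend 1 x = act_eta A x.
Proof.
have /= -> := extendE [::].
have /= K := bwdK (act_eta B) x.
by rewrite /= cmp1m cmpA K cmp1m.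
Qed.

Definition extension : action_mor A B := ActionMor extend_lam extend_eta.

Lemma res_extension : res_mor S extension = rho.
Proof.
apply: paction_mor_ext => x c /=.
have /= -> := extendE [:: x].
by rewrite /= fmap1 cmp1m !cmpm1.
Qed.

End Fullness.
End FullyFaithful.

Theorem coherence_criterion (M : monoidType) (S : presentation M)
    (P : path_relation S) :
  (forall (C : category) (F : paction S C), satisfies P F ->
    forall u v (f f' : nat_trans (wordF F u) (wordF F v)),
    canonical f -> canonical f' -> forall c, f c = f' c) ->
  coherent_presentation S P.
Proof.
move=> unique C; apply: ff_eso_equivalence => /=.
- by move=> A B rho; exists (extension rho); apply: res_extension.
- by move=> A B r s; apply: res_mor_faithful.
- move=> [F satF] /=; have uniq := unique C F satF.
  exists (nf_action uniq), (to_letters uniq), (from_letters uniq).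
  by split; [apply: from_to_letters | apply: to_from_letters].
Qed.

(** * Sliding letters through runs *)

Definition distant (N s t : nat) : bool :=
  [&& s < N, t < N & (s.+1 < t) || (t.+1 < s)].

Section Data.
Variable C : category.

(* The letters are numbered backwards, so that k' is k + 1: the letters after
   the first one then form an instance of the same structure, see [shift]. *)
Record hecke_data (N : nat) := HeckeData {
  hG :> nat -> functor C C;
  ha : forall i Y, hom (hG i (hG i Y)) (hG i Y);
  hb : forall i, i.+1 < N -> forall Y,
    hom (hG i (hG i.+1 (hG i Y))) (hG i.+1 (hG i (hG i.+1 Y)));
  hc : forall s t, distant N s t -> forall Y,
    hom (hG s (hG t Y)) (hG t (hG s Y));
  haN : forall i Y Z (f : hom Y Z),
    fmap (hG i) f \c ha i Y = ha i Z \c fmap (hG i) (fmap (hG i) f);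
  hbN : forall i (h : i.+1 < N) Y Z (f : hom Y Z),
    fmap (hG i.+1) (fmap (hG i) (fmap (hG i.+1) f)) \c hb h Y =
    hb h Z \c fmap (hG i) (fmap (hG i.+1) (fmap (hG i) f));
  hcN : forall s t (h : distant N s t) Y Z (f : hom Y Z),
    fmap (hG t) (fmap (hG s) f) \c hc h Y =
    hc h Z \c fmap (hG s) (fmap (hG t) f);
  haI : forall i Y, exists g, g \c ha i Y = idm _;
  hbI : forall i (h : i.+1 < N) Y, exists g, g \c hb h Y = idm _;
  hP1 : forall s t (h : distant N s t) (h' : distant N t s) Y,
    hc h' Y \c hc h Y = idm _;
  hP2 : forall k Y, ha k Y \c fmap (hG k) (ha k Y) = ha k Y \c ha k (hG k Y);
  hP3 : forall k (h : k.+1 < N) Y,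
    hb h Y \c fmap (hG k) (fmap (hG k.+1) (ha k Y)) =
    ha k.+1 (hG k (hG k.+1 Y)) \c fmap (hG k.+1) (hb h Y) \c hb h (hG k Y);
  hP4 : forall k (h : k.+1 < N) Y,
    fmap (hG k.+1) (fmap (hG k) (ha k.+1 Y)) \c hb h (hG k.+1 Y) \c
      fmap (hG k) (hb h Y) =
    hb h Y \c ha k (hG k.+1 (hG k Y));
  hP5 : forall s t (h : distant N s t) Y,
    hc h Y \c fmap (hG s) (ha t Y) =
    ha t (hG s Y) \c fmap (hG t) (hc h Y) \c hc h (hG t Y);
  hP6 : forall k (h : k.+1 < N) Y,
    fmap (hG k.+1) (fmap (hG k) (ha k.+1 Y)) \c hb h (hG k.+1 Y) \c
      fmap (hG k) (ha k.+1 (hG k (hG k.+1 Y))) \c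
      fmap (hG k) (fmap (hG k.+1) (hb h Y)) =
    ha k.+1 (hG k (hG k.+1 Y)) \c fmap (hG k.+1) (hb h Y) \c
      fmap (hG k.+1) (fmap (hG k) (ha k.+1 (hG k Y))) \c
      hb h (hG k.+1 (hG k Y));
  hP7 : forall s t (h : s.+1 < N) (ts : distant N t s)
      (ts' : distant N t s.+1) Y,
    fmap (hG s.+1) (fmap (hG s) (hc ts' Y)) \c
      fmap (hG s.+1) (hc ts (hG s.+1 Y)) \c
      hc ts' (hG s (hG s.+1 Y)) \c fmap (hG t) (hb h Y) =
    hb h (hG t Y) \c fmap (hG s) (fmap (hG s.+1) (hc ts Y)) \c
      fmap (hG s) (hc ts' (hG s Y)) \c hc ts (hG s.+1 (hG s Y));
  hP8 : forall i j k (ji : distant N j i) (ki : distant N k i)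
      (kj : distant N k j) Y,
    fmap (hG i) (hc kj Y) \c hc ki (hG j Y) \c fmap (hG k) (hc ji Y) =
    hc ji (hG k Y) \c fmap (hG j) (hc ki Y) \c hc kj (hG i Y);
  (* The letters k1, k, k' of P9 are here k, k + 1, k + 2. *)
  hP9 : forall k (h1 : k.+1 < N) (h : k.+2 < N) (f : distant N k k.+2)
      (f' : distant N k.+2 k) Y,
    fmap (hG k.+2) (fmap (hG k.+1) (hc f (hG k.+1 (hG k.+2 Y)))) \c
    fmap (hG k.+2) (fmap (hG k.+1) (fmap (hG k) (hb h Y))) \c
    fmap (hG k.+2) (hb h1 (hG k.+2 (hG k.+1 Y))) \c
    fmap (hG k.+2) (fmap (hG k) (fmap (hG k.+1) (hc f' (hG k.+1 Y)))) \c
    hc f (hG k.+1 (hG k.+2 (hG k (hG k.+1 Y)))) \c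
    fmap (hG k) (hb h (hG k (hG k.+1 Y))) \c
    fmap (hG k) (fmap (hG k.+1) (fmap (hG k.+2) (hb h1 Y))) =
    hb h (hG k (hG k.+1 (hG k.+2 Y))) \c
    fmap (hG k.+1) (fmap (hG k.+2) (hb h1 (hG k.+2 Y))) \c
    fmap (hG k.+1) (fmap (hG k.+2) (fmap (hG k) (fmap (hG k.+1) (hc f' Y)))) \c
    fmap (hG k.+1) (hc f (hG k.+1 (hG k.+2 (hG k Y)))) \c
    fmap (hG k.+1) (fmap (hG k) (hb h (hG k Y))) \c
    hb h1 (hG k.+2 (hG k.+1 (hG k Y))) \c
    fmap (hG k) (fmap (hG k.+1) (hc f' (hG k.+1 (hG k Y))))
}.

(** Forgets the letter 0, that is T_N. The bounds of the shifted indices hold by conversion, so the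
    fields are reused unchanged. *)
Definition shift N (H : hecke_data N.+1) : hecke_data N :=
  @HeckeData N (fun i => H i.+1) (fun i => ha H i.+1) (fun i => @hb _ H i.+1)
    (fun s t => @hc _ H s.+1 t.+1)
    (fun i => @haN _ H i.+1) (fun i => @hbN _ H i.+1)
    (fun s t => @hcN _ H s.+1 t.+1)
    (fun i => @haI _ H i.+1) (fun i => @hbI _ H i.+1)
    (fun s t => @hP1 _ H s.+1 t.+1) (fun k => @hP2 _ H k.+1)
    (fun k => @hP3 _ H k.+1) (fun k => @hP4 _ H k.+1)
    (fun s t => @hP5 _ H s.+1 t.+1) (fun k => @hP6 _ H k.+1)
    (fun s t => @hP7 _ H s.+1 t.+1)
    (fun i j k => @hP8 _ H i.+1 j.+1 k.+1) (fun k => @hP9 _ H k.+1).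

End Data.

Section Slide.
Variables (C : category) (N : nat) (H : hecke_data C N).
Implicit Types Y Z : C.

Lemma distant_sym s t : distant N s t -> distant N t s.
Proof. rewrite /distant; lia. Qed.

(** In [hP5] a letter crosses a doubled letter; here the doubled letter does the sliding. The two
    forms differ by crossings that [hP1] inverts. *)
Lemma hP5l s t (h : distant N s t) Y :
  fmap (H t) (ha H s Y) \c (hc H h (H s Y) \c fmap (H s) (hc H h Y)) =
  hc H h Y \c ha H s (H t Y).
Proof.
pose h' := distant_sym h.
apply: (@cmp_mono _ _ _ _ (hc H h' Y) _ _ _ (hP1 H h' h Y)).
rewrite !cmpA hP1 cmp1m hP5 cmp_cancel ?hP1 //.
by rewrite -cmpA -fmapM hP1 fmap1 cmpm1.
Qed.

(** In [hP7] the letter [t] crosses a braid from the left; here the braid slides through [t], after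
    the three crossings are inverted by [hP1]. *)
Lemma hP7l s t (h : s.+1 < N) (st : distant N s t) (s't : distant N s.+1 t) Y :
  fmap (H t) (hb H h Y) \c (hc H st (H s.+1 (H s Y)) \c
    (fmap (H s) (hc H s't (H s Y)) \c fmap (H s) (fmap (H s.+1) (hc H st Y)))) =
  hc H s't (H s (H s.+1 Y)) \c (fmap (H s.+1) (hc H st (H s.+1 Y)) \c
    (fmap (H s.+1) (fmap (H s) (hc H s't Y)) \c hb H h (H t Y))).
Proof.
pose ts := distant_sym st; pose ts' := distant_sym s't.
apply: (@cmp_mono _ _ _ _ (hc H ts' _) _ _ _ (hP1 H ts' s't _)).
rewrite [RHS]cmpA hP1 cmp1m.
have fK i u v (f : hom u v) g : g \c f = idm u ->
  fmap (H i) g \c fmap (H i) f = idm (H i u).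
  by move=> e; rewrite -fmapM e fmap1.
apply: (@cmp_mono _ _ _ _ (fmap (H s.+1) (hc H ts _)) _ _ _
  (fK _ _ _ _ _ (hP1 H ts st _))).
rewrite [RHS]cmpA fK ?hP1 // cmp1m.
apply: (@cmp_mono _ _ _ _ (fmap (H s.+1) (fmap (H s) (hc H ts' _))) _ _ _
  (fK _ _ _ _ _ (fK _ _ _ _ _ (hP1 H ts' s't _)))).
rewrite [RHS]cmpA !fK ?hP1 // cmp1m !cmpA hP7.
by rewrite !(cmp_cancel, fK, hP1) // -cmpA !(cmp_cancel, fK, hP1) // cmpm1.
Qed.

(* Sliding a letter [x] through [E], turning it into [x']; the predicates say
   that the slides carry a rule for the letters before to the corresponding
   rule for the letters after. *)
Definition slide_a (E : functor C C) x x'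
    (th : forall Y, hom (H x (E Y)) (E (H x' Y))) : Prop :=
  forall Y, fmap E (ha H x' Y) \c (th (H x' Y) \c fmap (H x) (th Y)) =
            th Y \c ha H x (E Y).

Definition slide_b (E : functor C C) k l
    (h : k.+1 < N) (h' : l.+1 < N)
    (th : forall Y, hom (H k (E Y)) (E (H l Y)))
    (th' : forall Y, hom (H k.+1 (E Y)) (E (H l.+1 Y))) : Prop :=
  forall Y,
    fmap E (hb H h' Y) \c (th (H l.+1 (H l Y)) \c
      (fmap (H k) (th' (H l Y)) \c fmap (H k) (fmap (H k.+1) (th Y)))) =
    th' (H l (H l.+1 Y)) \c (fmap (H k.+1) (th (H l.+1 Y)) \c
      (fmap (H k.+1) (fmap (H k) (th' Y)) \c hb H h (E Y))).

Definition slide_c (E : functor C C) s t s' t'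
    (h : distant N s t) (h' : distant N s' t')
    (th : forall Y, hom (H s (E Y)) (E (H s' Y)))
    (th' : forall Y, hom (H t (E Y)) (E (H t' Y))) : Prop :=
  forall Y,
    fmap E (hc H h' Y) \c (th (H t' Y) \c fmap (H s) (th' Y)) =
    th' (H s' Y) \c (fmap (H t) (th Y) \c hc H h (E Y)).

Definition slide_nat (E : functor C C) x x'
    (th : forall Y, hom (H x (E Y)) (E (H x' Y))) : Prop :=
  forall Y Z (f : hom Y Z),
    fmap E (fmap (H x') f) \c th Y = th Z \c fmap (H x) (fmap E f).

Definition slide_comp (E K : functor C C) x x' x''
    (th : forall Y, hom (H x (E Y)) (E (H x' Y)))
    (th' : forall Y, hom (H x' (K Y)) (K (H x'' Y))) :
    forall Y, hom (H x (fcomp E K Y)) (fcomp E K (H x'' Y)) :=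
  fun Y => fmap E (th' Y) \c th (K Y).

Section Comp.
Variables E K : functor C C.

Lemma slide_comp_nat x x' x'' (th : forall Y, hom (H x (E Y)) (E (H x' Y)))
    (th' : forall Y, hom (H x' (K Y)) (K (H x'' Y))) :
  slide_nat th -> slide_nat th' -> slide_nat (slide_comp th th').
Proof.
move=> n n' Y Z f; rewrite /slide_comp /= !cmpA -fmapM n' fmapM -!cmpA.
by congr (_ \c _); rewrite n.
Qed.

(** Naturality of [th] moves its second occurrence past [th'], after which the two given squares
    paste. By this lemma and its analogues for the other rules, only the places of a run where an
    index changes need a separate check. *)
Lemma slide_comp_a x x' x'' (th : forall Y, hom (H x (E Y)) (E (H x' Y)))
    (th' : forall Y, hom (H x' (K Y)) (K (H x'' Y))) :
  slide_nat th -> slide_a th -> slide_a th' -> slide_a (slide_comp th th').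
Proof.
move=> n e e' Y; rewrite /slide_comp /= !fmapM.
move: (e (K Y)) (congr1 (fmap E) (e' Y)) (n _ _ (th' Y)).
rewrite !fmapM => {}e {}e' {}n.
rewrite -!cmpA -e !cmpA -[_ \c th _ \c _]cmpA -n !cmpA.
by rewrite -[_ \c _ \c fmap E (fmap (H x') _)]cmpA e'.
Qed.

Lemma slide_comp_c s t s' t' s'' t'' (h : distant N s t) (h' : distant N s' t')
    (h'' : distant N s'' t'')
    (th : forall Y, hom (H s (E Y)) (E (H s' Y)))
    (ph : forall Y, hom (H t (E Y)) (E (H t' Y)))
    (th' : forall Y, hom (H s' (K Y)) (K (H s'' Y)))
    (ph' : forall Y, hom (H t' (K Y)) (K (H t'' Y))) :
  slide_nat th -> slide_nat ph ->
  slide_c h h' th ph -> slide_c h' h'' th' ph' ->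
  slide_c h h'' (slide_comp th th') (slide_comp ph ph').
Proof.
move=> n m e e' Y; rewrite /slide_comp /= !fmapM.
move: (e (K Y)) (congr1 (fmap E) (e' Y)) (n _ _ (ph' Y)) (m _ _ (th' Y)).
rewrite !fmapM => {}e {}e' {}n {}m.
rewrite -!cmpA [in RHS](cmpA (ph _)) -m -!cmpA -e !cmpA.
by rewrite !cmpA in e' |- *; rewrite -e' -(cmpA _ (th _)) -n !cmpA.
Qed.

Lemma slide_comp_b k l p (h : k.+1 < N) (h' : l.+1 < N) (h'' : p.+1 < N)
    (th : forall Y, hom (H k (E Y)) (E (H l Y)))
    (ph : forall Y, hom (H k.+1 (E Y)) (E (H l.+1 Y)))
    (th' : forall Y, hom (H l (K Y)) (K (H p Y)))
    (ph' : forall Y, hom (H l.+1 (K Y)) (K (H p.+1 Y))) :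
  slide_nat th -> slide_nat ph ->
  slide_b h h' th ph -> slide_b h' h'' th' ph' ->
  slide_b h h'' (slide_comp th th') (slide_comp ph ph').
Proof.
move=> n m e e' Y; rewrite /slide_comp /= !fmapM.
move: (e (K Y)) (congr1 (fmap E) (e' Y)).
rewrite !fmapM => {}e {}e'.
have n2 Z W (f : hom Z W) V z : fmap E (fmap (H l) f) \c (th Z \c z) =
   th W \c (fmap (H k) (fmap E f) \c z) :> hom V _.
  by rewrite !cmpA n.
have m2 Z W (f : hom Z W) V z : fmap E (fmap (H l.+1) f) \c (ph Z \c z) =
   ph W \c (fmap (H k.+1) (fmap E f) \c z) :> hom V _.
  by rewrite !cmpA m.
have nk Z W (f : hom Z W) V z :
   fmap (H k.+1) (fmap E (fmap (H l) f)) \c (fmap (H k.+1) (th Z) \c z) =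
   fmap (H k.+1) (th W) \c (fmap (H k.+1) (fmap (H k) (fmap E f)) \c z)
     :> hom V _.
  by rewrite !cmpA -!fmapM n.
have mk Z W (f : hom Z W) V z :
   fmap (H k) (fmap E (fmap (H l.+1) f)) \c (fmap (H k) (ph Z) \c z) =
   fmap (H k) (ph W) \c (fmap (H k) (fmap (H k.+1) (fmap E f)) \c z)
     :> hom V _.
  by rewrite !cmpA -!fmapM m.
rewrite -!cmpA -mk -!n2 -nk -!m2 -e.
rewrite !cmpA in e' |- *. by rewrite -e'.
Qed.

End Comp.

Lemma slide_id_nat x : slide_nat (E := fid C) (fun Y => idm (H x Y)).
Proof. by move=> Y Z f /=; rewrite cmpm1 cmp1m. Qed.

Section Distant.
Variables s t y : nat.
Hypotheses (sy : distant N s y) (ty : distant N t y).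

Lemma slide_hc_nat : slide_nat (E := H y) (hc H sy).
Proof. exact: hcN. Qed.

Lemma slide_hc_a : slide_a (E := H y) (hc H sy).
Proof. by move=> Y; rewrite hP5l. Qed.

Lemma slide_hc_c (st : distant N s t) :
  slide_c (E := H y) st st (hc H sy) (hc H ty).
Proof. by move=> Y; rewrite !cmpA hP8. Qed.

End Distant.

Lemma slide_hc_b s y (h : s.+1 < N) (sy : distant N s y)
    (s'y : distant N s.+1 y) :
  slide_b (E := H y) h h (hc H sy) (hc H s'y).
Proof. by move=> Y; rewrite hP7l. Qed.

(** With letter i standing for T_(N - i), this is T_(N - m + 1) ... T_N. *)
Fixpoint run (m : nat) : functor C C :=
  if m is m'.+1 then fcomp (H m') (run m') else fid C.

(** In the case [above] the letter [x] commutes with every letter of [run m]; in the case [inside]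
    the run contains both [x.+1] and [x]. What remains is [x = m], which extends the run, and
    [x.+1 = m], which is absorbed. *)
Definition above x m := (m < x) && (x < N).
Definition inside x m := (x.+1 < m) && (m <= N).

Lemma above_distant x m : above x m.+1 -> distant N x m.
Proof. rewrite /above /distant; lia. Qed.

Lemma aboveW x m : above x m.+1 -> above x m.
Proof. rewrite /above; lia. Qed.

Lemma inside_distant x m : inside x m.+1 -> x.+1 <> m -> distant N x m.
Proof. rewrite /inside /distant; lia. Qed.

Lemma insideW x m : inside x m.+1 -> x.+1 <> m -> inside x m.
Proof. rewrite /inside; lia. Qed.

Lemma inside_above x : inside x x.+2 -> above x.+1 x.
Proof. rewrite /inside /above; lia. Qed.

Lemma inside_lt x : inside x x.+2 -> x.+1 < N.
Proof. rewrite /inside; lia. Qed.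

Lemma inside0 x : inside x 0 -> False.
Proof. by []. Qed.

Fixpoint pass x m :
    above x m -> forall Y, hom (H x (run m Y)) (run m (H x Y)) :=
  match m with
  | 0 => fun _ Y => idm (H x Y)
  | m'.+1 => fun h =>
      slide_comp (E := H m') (hc H (above_distant h)) (pass (aboveW h))
  end.

(* The letter [x] meets [x.+1; x] inside the run, where the rule [hb] turns it
   into [x.+1]. *)
Fixpoint climb x m :
    inside x m -> forall Y, hom (H x (run m Y)) (run m (H x.+1 Y)) :=
  match m with
  | 0 => fun h => False_rect _ (inside0 h)
  | m'.+1 =>
      match @eqP _ x.+1 m' with
      | ReflectT e =>
          match e in _ = m0 return inside x m0.+1 ->
            forall Y, hom (H x (run m0.+1 Y)) (run m0.+1 (H x.+1 Y)) with
          | erefl => fun h =>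
              slide_comp (E := fcomp (H x.+1) (H x)) (hb H (inside_lt h))
                (pass (inside_above h))
          end
      | ReflectF ne => fun h =>
          slide_comp (E := H m') (hc H (inside_distant h ne))
            (climb (insideW h ne))
      end
  end.

(** This equation and the next two unfold the recursion for arbitrary proofs of the bounds, so that
    they rewrite with whichever proofs are at hand. *)
Lemma passS x m (h : above x m.+1) (d : distant N x m) (h' : above x m) Y :
  pass h Y = fmap (H m) (pass h' Y) \c hc H d (run m Y).
Proof.
by rewrite /= (bool_irrelevance (above_distant h) d)
  (bool_irrelevance (aboveW h) h').
Qed.

Lemma climb_base x (h : inside x x.+2) (d : x.+1 < N) (h' : above x.+1 x) Y :
  climb h Y = fmap (H x.+1) (fmap (H x) (pass h' Y)) \c hb H d (run x Y).
Proof.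
move: h; rewrite /climb; case: eqP => // e.
rewrite (eq_irrelevance e erefl) => h.
by rewrite /slide_comp (bool_irrelevance (inside_lt h) d)
  (bool_irrelevance (inside_above h) h').
Qed.

Lemma climbS x m (h : inside x m.+1) (d : distant N x m) (h' : inside x m) Y :
  climb h Y = fmap (H m) (climb h' Y) \c hc H d (run m Y).
Proof.
move: h => /=; case: eqP => [e|ne h].
  by exfalso; subst m; move: d; rewrite /distant; lia.
by rewrite /slide_comp (bool_irrelevance (inside_distant h ne) d)
  (bool_irrelevance (insideW h ne) h').
Qed.

Lemma pass_nat x m (h : above x m) : slide_nat (pass h).
Proof.
elim: m h => [|m IH] h; first exact: slide_id_nat.
exact: slide_comp_nat (slide_hc_nat _) (IH _).
Qed.

Lemma hb_nat x (h : x.+1 < N) :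
  slide_nat (E := fcomp (H x.+1) (H x)) (hb H h).
Proof. exact: hbN. Qed.

Lemma climb_nat x m (h : inside x m) : slide_nat (climb h).
Proof.
elim: m h => [|m IH] h //=; move: h; case: eqP => [e|ne] h.
  by case: m / e {IH} h => h; apply: slide_comp_nat (hb_nat _) (pass_nat _).
exact: slide_comp_nat (slide_hc_nat _) (IH _).
Qed.

Lemma pass_a x m (h : above x m) : slide_a (pass h).
Proof.
elim: m h => [|m IH] h; first by move=> Y /=; rewrite !fmap1 !(cmpm1, cmp1m).
exact: slide_comp_a (slide_hc_nat _) (slide_hc_a _) (IH _).
Qed.

Lemma pass_c s t m (st : distant N s t) (h : above s m) (h' : above t m) :
  slide_c st st (pass h) (pass h').
Proof.
elim: m h h' => [|m IH] h h'.
  by move=> Y /=; rewrite !fmap1 !(cmpm1, cmp1m).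
apply: slide_comp_c (slide_hc_nat _) (slide_hc_nat _) _ (IH _ _).
exact: slide_hc_c.
Qed.

Lemma pass_b x m (d : x.+1 < N) (h : above x m) (h' : above x.+1 m) :
  slide_b d d (pass h) (pass h').
Proof.
elim: m h h' => [|m IH] h h'.
  by move=> Y /=; rewrite !fmap1 !(cmpm1, cmp1m).
apply: slide_comp_b (slide_hc_nat _) (slide_hc_nat _) _ (IH _ _).
exact: slide_hc_b.
Qed.

(** Away from the pair [x.+1], [x] the letter only crosses distant ones; at the pair the statement
    is [hP4]. *)
Lemma climb_a x m (h : inside x m) : slide_a (climb h).
Proof.
elim: m h => [|m IH] h //=; move: h; case: eqP => [e|ne] h.
  case: m / e {IH} h => h; apply: slide_comp_a (hb_nat _) _ (pass_a _) => Y /=.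
  by rewrite !cmpA hP4.
exact: slide_comp_a (slide_hc_nat _) (slide_hc_a _) (IH _).
Qed.

Lemma slide_compA (E K L : functor C C) x x1 x2 x3
    (th1 : forall Y, hom (H x (E Y)) (E (H x1 Y)))
    (th2 : forall Y, hom (H x1 (K Y)) (K (H x2 Y)))
    (th3 : forall Y, hom (H x2 (L Y)) (L (H x3 Y))) Y :
  slide_comp (slide_comp th1 th2) th3 Y = slide_comp th1 (slide_comp th2 th3) Y.
Proof. by rewrite /slide_comp /= fmapM cmpA. Qed.

(** The letter [t] commutes with the pair [s.+1], [s] at which [s] is raised, so the new case is
    [hP7], with the crossings of [t] moved to the other side. *)
Lemma climb_pass_c s t m (st : distant N s t) (s't : distant N s.+1 t)
    (h : inside s m) (h' : above t m) :
  slide_c st s't (climb h) (pass h').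
Proof.
elim: m h h' => [|m IH] h h' //=; move: h; case: eqP => [e|ne] h; last first.
  apply: slide_comp_c (slide_hc_nat _) (slide_hc_nat _) _ (IH _ _).
  exact: slide_hc_c.
case: m / e {IH} h h' => h h' Y.
pose ts := distant_sym st; pose ts' := distant_sym s't.
have S : slide_c (E := fcomp (fcomp (H s.+1) (H s)) (run s)) st s't
    (slide_comp (E := fcomp (H s.+1) (H s)) (hb H (inside_lt h))
       (pass (inside_above h)))
    (slide_comp (slide_comp (E := H s.+1) (K := H s) (hc H ts') (hc H ts))
       (pass (aboveW (aboveW h')))).
  apply: slide_comp_c (hb_nat _) _ _ (pass_c s't _ _).
    exact: slide_comp_nat (slide_hc_nat _) (slide_hc_nat _).
  move=> {}Y; rewrite /slide_comp /=.
  apply: (@cmp_epi _ _ _ _ (hc H ts _) (hc H st _)); first exact: hP1.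
  rewrite -!cmpA hP1 cmpm1 !cmpA.
  apply: (@cmp_mono _ _ _ _ (fmap (H s.+1) (fmap (H s) (hc H ts' Y)))
    (fmap (H s.+1) (fmap (H s) (hc H s't Y)))).
    by rewrite -!fmapM hP1 !fmap1.
  rewrite !cmpA -!fmapM hP1 !fmap1 cmp1m !fmapM !cmpA.
  by rewrite hP7.
move: (S Y); rewrite !slide_compA /=.
rewrite (bool_irrelevance ts' (above_distant h'))
  (bool_irrelevance ts (above_distant (aboveW h'))). exact.
Qed.

Arguments climb : simpl never.
Arguments pass : simpl never.

(** As [s < t], the pair that raises [t] comes first in the run. There [s] merely commutes, which is
    [hP7]; behind it [t.+1] passes while [s] still climbs, which is [climb_pass_c]. *)
Lemma climb_c s t m (st : distant N s t) (s't' : distant N s.+1 t.+1)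
    (h : inside s m) (h' : inside t m) : s < t ->
  slide_c st s't' (climb h) (climb h').
Proof.
move=> lt_st; elim: m h h' => [|m IH] h h' //.
have sm : distant N s m.
  by move: h h' (st); rewrite /inside /distant; lia.
have hm : inside s m.
  by move: h h' (st); rewrite /inside /distant; lia.
have [e|/eqP ne] := eqVneq t.+1 m; last first.
  have tm := inside_distant h' ne.
  have S : slide_c st s't' (slide_comp (E := H m) (hc H sm) (climb hm))
      (slide_comp (E := H m) (hc H tm) (climb (insideW h' ne))).
    apply: slide_comp_c (slide_hc_nat _) (slide_hc_nat _) _ (IH _ _).
    exact: slide_hc_c.
  by move=> Y; move: (S Y); rewrite /slide_comp -!(climbS h') -!(climbS h).
case: m / e {IH} h h' sm hm => h h' st' hm.
have d := inside_lt h'; have h0 := inside_above h'.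
have hs : inside s t by move: hm (st) lt_st; rewrite /inside /distant; lia.
have S : slide_c (E := fcomp (fcomp (H t.+1) (H t)) (run t)) st s't'
    (slide_comp (slide_comp (E := H t.+1) (K := H t) (hc H st') (hc H st))
       (climb hs))
    (slide_comp (E := fcomp (H t.+1) (H t)) (hb H d) (pass h0)).
  apply: slide_comp_c _ (hb_nat _) _ (climb_pass_c st' s't' _ _).
    exact: slide_comp_nat (slide_hc_nat _) (slide_hc_nat _).
  by move=> Y; rewrite /slide_comp /= !fmapM !cmpA hP7.
move=> Y; move: (S Y); rewrite !slide_compA /= /slide_comp.
by rewrite -!(climbS hm) -!(climbS h) -!(climb_base h').
Qed.

(** Both letters are raised within the triple [x.+2], [x.+1], [x], where the statement is [hP9];
    behind it the raised letters pass the rest of the run. *)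
Lemma climb_b x m (d : x.+1 < N) (d' : x.+2 < N)
    (h : inside x m) (h' : inside x.+1 m) :
  slide_b d d' (climb h) (climb h').
Proof.
elim: m h h' => [|m IH] h h' //.
have xm : distant N x m by move: h h'; rewrite /inside /distant; lia.
have hm : inside x m by move: h h'; rewrite /inside; lia.
have [e|/eqP ne] := eqVneq x.+2 m; last first.
  have tm := inside_distant h' ne.
  have S : slide_b d d' (slide_comp (E := H m) (hc H xm) (climb hm))
      (slide_comp (E := H m) (hc H tm) (climb (insideW h' ne))).
    apply: slide_comp_b (slide_hc_nat _) (slide_hc_nat _) _ (IH _ _).
    exact: slide_hc_b.
  by move=> Y; move: (S Y); rewrite /slide_comp -!(climbS h') -!(climbS h).
case: m / e {IH} h h' xm hm => h h' f hm.
pose f' := distant_sym f.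
have h0 := inside_above h'; have h1 := aboveW h0; have h2 := inside_above hm.
have S : slide_b
    (E := fcomp (fcomp (H x.+2) (fcomp (H x.+1) (H x))) (run x)) d d'
    (slide_comp (slide_comp (E := H x.+2) (K := fcomp (H x.+1) (H x))
       (hc H f) (hb H d)) (pass h2))
    (slide_comp (slide_comp (E := fcomp (H x.+2) (H x.+1)) (K := H x)
       (hb H d') (hc H f')) (pass h1)).
  apply: slide_comp_b _ _ _ (pass_b d' _ _).
  - exact: slide_comp_nat (slide_hc_nat _) (hb_nat _).
  - exact: slide_comp_nat (hb_nat _) (slide_hc_nat _).
  move=> Y; rewrite /slide_comp /= !fmapM !cmpA.
  have n V (z : hom _ V) : z \c hc H f _ \c
      fmap (H x) (fmap (H x.+2) (fmap (H x.+1) (hc H f' (H x.+1 Y)))) =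
      z \c fmap (H x.+2) (fmap (H x) (fmap (H x.+1) (hc H f' (H x.+1 Y))))
        \c hc H f _.
    by rewrite -!cmpA hcN.
  have n' V (z : hom _ V) : z \c fmap (H x.+1) (hc H f _) \c
      fmap (H x.+1) (fmap (H x) (fmap (H x.+2) (fmap (H x.+1) (hc H f' Y)))) =
      z \c
        fmap (H x.+1) (fmap (H x.+2) (fmap (H x) (fmap (H x.+1) (hc H f' Y))))
        \c fmap (H x.+1) (hc H f _).
    by rewrite -!cmpA -!fmapM hcN.
  rewrite n n'.
  have K : fmap (H x.+2) (fmap (H x.+1) (hc H f' _)) \c
      fmap (H x.+2) (fmap (H x.+1) (hc H f (H x.+1 (H x.+2 Y)))) = idm _.
    by rewrite -!fmapM hP1 !fmap1.
  have K' : fmap (H x) (fmap (H x.+1) (hc H f' _)) \c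
      fmap (H x) (fmap (H x.+1) (hc H f (H x.+1 (H x Y)))) = idm _.
    by rewrite -!fmapM hP1 !fmap1.
  (* [hP9] has one crossing of [x] and [x.+2] too many at either end; composing with the inverse
     crossings removes them. *)
  have /= := hP9 H d d' f f' Y.
  move=> /(congr1 (fun z => fmap (H x.+2) (fmap (H x.+1) (hc H f' _)) \c z \c
      fmap (H x) (fmap (H x.+1) (hc H f (H x.+1 (H x Y)))))).
  by rewrite !cmpA K cmp1m => ->; rewrite -!cmpA K' cmpm1.
move=> Y; move: (S Y); rewrite !slide_compA /= /slide_comp /=.
by rewrite -!(climb_base hm) -!(passS h0) -!(climb_base h') -!(climbS h).
Qed.

End Slide.
Arguments climb : simpl never.
Arguments pass : simpl never.

(** * Insertion of letters into normal forms *)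

Section Insertion.
Variable C : category.

(** The lengths of the runs. There are (N + 1)! states, as many as permutations in Sigma_(N + 1). *)
Fixpoint state N : Type :=
  if N is N'.+1 then ('I_N.+1 * state N')%type else unit.

Fixpoint normal_form N : hecke_data C N -> state N -> functor C C :=
  match N with
  | 0 => fun _ _ => fid C
  | N'.+1 => fun H q => fcomp (run H q.1) (normal_form (shift H) q.2)
  end.

Definition elt N (H : hecke_data C N) X c :=
  {q : state N & hom X (normal_form H q c)}.

Definition pre N (H : hecke_data C N) X Y c (h : hom Y X) (p : elt H X c) :
    elt H Y c :=
  existT _ (projT1 p) (projT2 p \c h).

Lemma pre_comp N (H : hecke_data C N) X Y Z c (h : hom Y X) (k : hom Z Y)
    (p : elt H X c) :
  pre k (pre h p) = pre (h \c k) p.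
Proof. by rewrite /pre /= cmpA. Qed.

Lemma pre_id N (H : hecke_data C N) X c (p : elt H X c) : pre (idm X) p = p.
Proof. by case: p => q f; rewrite /pre /= cmpm1. Qed.

Section Level.
Variables (N : nat) (H : hecke_data C N.+1) (c : C).

(* The element with first run of length [m] whose remaining runs are those of
   [p], reached along [f]. *)
Definition on_run (m : nat) (hm : m < N.+2) Y (p : elt (shift H) Y c) X
    (f : hom X (run H m Y)) : elt H X c :=
  existT (fun q : state N.+1 => hom X (normal_form H q c))
    (Ordinal hm, projT1 p) (fmap (run H m) (projT2 p) \c f).

Lemma on_run_pre m (hm : m < N.+2) Y Z (p : elt (shift H) Y c) (h : hom Z Y) X
    (f : hom X (run H m Z)) :
  on_run hm (pre h p) f = on_run hm p (fmap (run H m) h \c f).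
Proof. by rewrite /on_run /= fmapM cmpA. Qed.

Lemma pre_on_run m (hm : m < N.+2) Y (p : elt (shift H) Y c) X W
    (f : hom X (run H m Y)) (h : hom W X) :
  pre h (on_run hm p f) = on_run hm p (f \c h).
Proof. by rewrite /on_run /pre /= cmpA. Qed.

Inductive position x m : Type :=
| Next of x = m
| Top of x.+1 = m
| Inner of x.+1 < m
| Outer of m < x.

(** The four cases exclude one another; hence a rule can be checked with any convenient proof of the
    position. *)
Lemma position_irrelevance x m (p q : position x m) : p = q.
Proof.
case: p => [p|p|p|p]; case: q => [q|q|q|q]; try (exfalso; lia); congr (_ _).
- exact: eq_irrelevance.
- exact: eq_irrelevance.
- exact: bool_irrelevance.
- exact: bool_irrelevance.
Qed.

Lemma positionP x m : position x m.
Proof.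
have [lt|gt|e] := ltngtP x m; last exact: Next.
  by have [e|ne] := eqVneq x.+1 m; [exact: Top | apply: Inner; lia].
exact: Outer.
Qed.

Lemma insideP x m : m < N.+2 -> x.+1 < m -> inside N.+1 x m.
Proof. rewrite /inside; lia. Qed.

Lemma aboveP x m : x < N.+1 -> m < x -> above N.+1 x m.
Proof. rewrite /above; lia. Qed.

Lemma inner_lt x m : m < N.+2 -> x.+1 < m -> x < N.
Proof. lia. Qed.

Variable ins' : forall x, x < N -> forall X,
  elt (shift H) X c -> elt (shift H) (H x.+1 X) c.

(** A letter greater than [m] is a successor, and [x'.+1] is by conversion the letter [x'] of
    [shift H]; hence the match on [x]. *)
Definition insert_outer x : x < N.+1 -> forall m (hm : m < N.+2), m < x ->
    forall Y (p : elt (shift H) Y c) X, hom X (run H m Y) -> elt H (H x X) c :=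
  match x with
  | 0 => fun _ m hm lt => False_rect _ (notF lt)
  | x'.+1 => fun hx m hm lt Y p X f =>
      on_run hm (ins' hx p) (pass H (aboveP hx lt) Y \c fmap (H x'.+1) f)
  end.

Definition insert_at x (hx : x < N.+1) m (hm : m < N.+2) (v : position x m) Y
    (p : elt (shift H) Y c) X : hom X (run H m Y) -> elt H (H x X) c :=
  match v with
  | Next e =>
      match e in _ = m0 return hom X (run H m0 Y) -> elt H (H x X) c with
      | erefl => fun f => @on_run x.+1 hx Y p _ (fmap (H x) f)
      end
  | Top e =>
      match e in _ = m0 return hom X (run H m0 Y) -> elt H (H x X) c with
      | erefl => fun f =>
          @on_run x.+1 hx Y p _ (ha H x (run H x Y) \c fmap (H x) f)
      end
  | Inner lt => fun f =>
      on_run hm (ins' (inner_lt hm lt) p)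
        (climb H (insideP hm lt) Y \c fmap (H x) f)
  | Outer lt => fun f => insert_outer hx hm lt p f
  end.

Definition insertS x (hx : x < N.+1) X (P : elt H X c) : elt H (H x X) c :=
  insert_at hx (ltn_ord (projT1 P).1) (positionP x (projT1 P).1)
    (existT (fun q => hom (normal_form (shift H) (projT1 P).2 c)
                        (normal_form (shift H) q c))
       (projT1 P).2 (idm _)) (projT2 P).

Hypothesis ins'_pre : forall x (hx : x < N) X Y (h : hom Y X)
    (p : elt (shift H) X c),
  ins' hx (pre h p) = pre (fmap (H x.+1) h) (ins' hx p).

Lemma insert_at_pre x (hx : x < N.+1) m (hm : m < N.+2) (v : position x m) Y
    (p : elt (shift H) Y c) X W (f : hom X (run H m Y)) (h : hom W X) :
  insert_at hx hm v p (f \c h) = pre (fmap (H x) h) (insert_at hx hm v p f).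
Proof.
case: v => [e|e|lt|lt] /=.
- by case: m / e {hm} f => f; rewrite pre_on_run fmapM.
- by case: m / e {hm} f => f; rewrite pre_on_run fmapM cmpA.
- by rewrite pre_on_run fmapM cmpA.
- case: x hx lt => //= x hx lt.
  by rewrite pre_on_run fmapM cmpA.
Qed.

Lemma insertS_pre x (hx : x < N.+1) X W (h : hom W X) (P : elt H X c) :
  insertS hx (pre h P) = pre (fmap (H x) h) (insertS hx P).
Proof. exact: insert_at_pre. Qed.

Lemma insert_at_run x (hx : x < N.+1) m (hm : m < N.+2) (v : position x m) Y Z
    (p : elt (shift H) Y c) (h : hom Z Y) X (f : hom X (run H m Z)) :
  insert_at hx hm v (pre h p) f = insert_at hx hm v p (fmap (run H m) h \c f).
Proof.
case: v => [e|e|lt|lt] /=.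
- by case: m / e {hm} f => f; rewrite on_run_pre /= fmapM.
- case: m / e {hm} f => f; rewrite on_run_pre /= fmapM !cmpA.
  by rewrite haN.
- rewrite ins'_pre on_run_pre fmapM !cmpA; congr (on_run _ _ (_ \c _)).
  exact: climb_nat.
- case: x hx lt => //= x hx lt.
  rewrite ins'_pre on_run_pre fmapM !cmpA; congr (on_run _ _ (_ \c _)).
  exact: pass_nat.
Qed.

(** [insertS] takes the remaining runs with an identity arrow, while one element has many
    descriptions by [on_run]. By [insert_at_run] the arrow of [p] may be moved into [f], so all
    descriptions give the same insertion. *)
Lemma insertSE x (hx : x < N.+1) m (hm : m < N.+2) (v : position x m) Y
    (p : elt (shift H) Y c) X (f : hom X (run H m Y)) :
  insertS hx (on_run hm p f) = insert_at hx hm v p f.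
Proof.
rewrite /insertS /= (bool_irrelevance (ltn_ord (Ordinal hm)) hm).
rewrite (position_irrelevance (positionP x m) v).
rewrite -insert_at_run.
rewrite (_ : pre _ _ = p) //.
by rewrite /pre /= cmp1m; case: p.
Qed.

End Level.

Fixpoint insert N : forall (H : hecke_data C N) c x, x < N -> forall X,
    elt H X c -> elt H (H x X) c :=
  match N with
  | 0 => fun _ _ _ hx => False_rect _ (notF hx)
  | N'.+1 => fun H c => insertS (@insert N' (shift H) c)
  end.

Lemma insert_pre N (H : hecke_data C N) c x (hx : x < N) X Y (h : hom Y X)
    (p : elt H X c) :
  insert hx (pre h p) = pre (fmap (H x) h) (insert hx p).
Proof. by case: N H hx p => // N H hx p; apply: insertS_pre. Qed.

Section LevelRules.
Variables (N : nat) (H : hecke_data C N.+1) (c : C).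
Variables (Y : C) (p : elt (shift H) Y c).

Lemma insert_next x (hx : x < N.+1) (hm : x < N.+2) X (f : hom X (run H x Y)) :
  insert hx (on_run hm p f) = on_run (m := x.+1) hx p (fmap (H x) f).
Proof.
exact: (insertSE (@insert_pre N (shift H) c) hx hm (Next (erefl x))).
Qed.

Lemma insert_top x (hx : x < N.+1) (hm : x.+1 < N.+2) X
    (f : hom X (run H x.+1 Y)) :
  insert hx (on_run hm p f) =
  on_run hm p (ha H x (run H x Y) \c fmap (H x) f).
Proof.
rewrite /= (insertSE (@insert_pre N (shift H) c) hx hm (Top (erefl x.+1))) /=.
by rewrite (bool_irrelevance hm hx).
Qed.

Lemma insert_inner x (hx : x < N.+1) m (hm : m < N.+2) (hx' : x < N)
    (h : inside N.+1 x m) X (f : hom X (run H m Y)) :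
  insert hx (on_run hm p f) =
  on_run hm (insert (H := shift H) hx' p) (climb H h Y \c fmap (H x) f).
Proof.
have lt : x.+1 < m by case/andP: h.
rewrite /= (insertSE (@insert_pre N (shift H) c) hx hm (Inner lt)) /=.
by rewrite (bool_irrelevance (inner_lt hm lt) hx')
  (bool_irrelevance (insideP hm lt) h).
Qed.

Lemma insert_outerE x (hx : x.+1 < N.+1) m (hm : m < N.+2) (hx' : x < N)
    (h : above N.+1 x.+1 m) X (f : hom X (run H m Y)) :
  insert hx (on_run hm p f) =
  on_run hm (insert (H := shift H) hx' p) (pass H h Y \c fmap (H x.+1) f).
Proof.
have lt : m < x.+1 by case/andP: h.
rewrite /= (insertSE (@insert_pre N (shift H) c) hx hm (Outer lt)) /=.
by rewrite (bool_irrelevance (aboveP hx lt) h) (bool_irrelevance hx hx').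
Qed.

Lemma on_run_ext m (hm hm' : m < N.+2) X (f f' : hom X (run H m Y)) :
  f = f' -> on_run hm p f = on_run hm' p f'.
Proof. by move=> ->; rewrite (bool_irrelevance hm hm'). Qed.

End LevelRules.

(** Reduces a rule to an identity arrow in front of the run: insertion commutes with restriction,
    and the rules are natural. *)
Lemma on_runE N (H : hecke_data C N.+1) X c (P : elt H X c) :
  exists m (hm : m < N.+2) Y (p : elt (shift H) Y c) (f : hom X (run H m Y)),
    P = pre f (on_run hm p (idm _)).
Proof.
case: P => [[[m hm] q] f]; exists m, hm, (normal_form (shift H) q c).
by exists (existT _ q (idm _)), f; rewrite /pre /on_run /= fmap1 !cmp1m.
Qed.

Definition rule_a N (H : hecke_data C N) :=
  forall c x (hx : x < N) X (P : elt H X c),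
  insert hx (insert hx P) = pre (ha H x X) (insert hx P).

Definition rule_b N (H : hecke_data C N) :=
  forall c x (h : x.+1 < N) (hx : x < N) (hx' : x.+1 < N) X (P : elt H X c),
  insert hx (insert hx' (insert hx P)) =
  pre (hb H h X) (insert hx' (insert hx (insert hx' P))).

Definition rule_c N (H : hecke_data C N) :=
  forall c s t (st : distant N s t) (hs : s < N) (ht : t < N) X (P : elt H X c),
  insert hs (insert ht P) = pre (hc H st X) (insert ht (insert hs P)).

(** Extending and then absorbing is the rule itself; absorbing twice is [hP2]. In the other two
    positions the slide carries the rule to the remaining runs. *)
Lemma insert_a N (H : hecke_data C N) : rule_a H.
Proof.
elim: N H => // N IH H c x hx X P.
have [m [hm [Y [p [f ->]]]]] := on_runE P.
rewrite !insert_pre pre_comp haN -pre_comp; congr (pre _ _) => {X P f}.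
have [e|e|lt|lt] := positionP x m.
- case: m / e hm => hm.
  by rewrite insert_next insert_top pre_on_run !fmap1 cmp1m cmpm1.
- case: m / e hm => hm.
  rewrite !insert_top pre_on_run !fmap1 !cmpm1; apply: on_run_ext.
  exact: hP2.
- have hx' := inner_lt hm lt.
  rewrite !(insert_inner _ _ _ hx' (insideP hm lt)) !fmap1 !cmpm1 IH.
  rewrite pre_on_run on_run_pre; apply: on_run_ext.
  exact: climb_a.
- case: x hx lt => // x hx lt.
  have h := aboveP hx lt; have hx' : x < N := hx.
  rewrite !(insert_outerE _ _ _ hx' h) !fmap1 !cmpm1 IH.
  rewrite pre_on_run on_run_pre; apply: on_run_ext.
  exact: pass_a.
Qed.

(** For [s < t], if neither letter ends in the run, sliding carries the rule to the next level. If
    [s] extends the run, its crossing cancels by [hP1]; if [t] does, the sides agree by the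
    recursion for [climb]; if one is absorbed, [hP5] is used. *)
Lemma insert_c N (H : hecke_data C N) : rule_c H.
Proof.
elim: N H => // N IH H.
suff S : forall c s t (st : distant N.+1 s t) (hs : s < N.+1) (ht : t < N.+1) X
    (P : elt H X c), s < t ->
    insert hs (insert ht P) = pre (hc H st X) (insert ht (insert hs P)).
  move=> c s t st hs ht X P; have [lt|gt|e] := ltngtP s t.
  - exact: S.
  - rewrite (S _ _ _ (distant_sym st)) // pre_comp hP1 pre_id //.
  - by exfalso; subst t; move: st; rewrite /distant; lia.
move=> c s t st hs ht X P lt_st.
have [m [hm [Y [p [f ->]]]]] := on_runE P.
rewrite !insert_pre pre_comp hcN -pre_comp; congr (pre _ _) => {X P f}.
have far_t : s.+1 < t by move: (st) lt_st; rewrite /distant; lia.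
case: t st ht lt_st far_t => // t st ht lt_st far_t.
have ht' : t < N by [].
have [e|e|lts|lts] := positionP s m.
- case: m / e hm => hm.
  have h1 : above N.+1 t.+1 s.+1 by rewrite /above; lia.
  have h0 := aboveW h1.
  rewrite (insert_outerE _ _ _ ht' h0) !insert_next.
  rewrite (insert_outerE _ _ _ ht' h1) pre_on_run; apply: on_run_ext.
  rewrite !fmap1 !cmpm1 (passS H h1 (distant_sym st) h0) -cmpA hP1 cmpm1.
  by [].
- case: m / e hm => hm.
  have h1 : above N.+1 t.+1 s.+1 by rewrite /above; lia.
  have h0 := aboveW h1.
  rewrite (insert_outerE _ _ _ ht' h1) !insert_top.
  rewrite (insert_outerE _ _ _ ht' h1) pre_on_run; apply: on_run_ext.
  rewrite !fmap1 !cmpm1 (passS H h1 (distant_sym st) h0) !fmapM !cmpA.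
  have /= E := hP5 H (distant_sym st) (run H s Y).
  rewrite -haN -[in RHS](cmpA (fmap (H s) _)) E.
  rewrite -!cmpA hP1 cmpm1 !cmpA.
  by [].
- have hs' : s < N by lia.
  have [e|e|ltt|ltt] := positionP t.+1 m.
  + case: m / e hm lts => hm lts.
    have h0 := insideP hm lts.
    have h1 : inside N.+1 s t.+2 by move: h0 ht; rewrite /inside; lia.
    rewrite (insert_inner _ _ _ hs' h0) !insert_next.
    rewrite (insert_inner _ _ _ hs' h1) pre_on_run; apply: on_run_ext.
    by rewrite !fmap1 !cmpm1 (climbS H h1 st h0).
  + case: m / e hm lts => hm lts.
    have h1 := insideP hm lts.
    have h0 : inside N.+1 s t.+1 by move: h1 far_t; rewrite /inside; lia.
    rewrite !insert_top !(insert_inner _ _ _ hs' h1) insert_top.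
    rewrite pre_on_run; apply: on_run_ext.
    rewrite !fmap1 !cmpm1 (climbS H h1 st h0) !fmapM !cmpA -haN.
    have /= E := hP5 H st (run H t.+1 Y).
    by rewrite -[in LHS]cmpA E !cmpA.
  + have ht'' : t.+1 < N by lia.
    have st' : distant N s t.+1 by move: (st) ht''; rewrite /distant; lia.
    have h := insideP hm lts; have h' := insideP hm ltt.
    rewrite !(insert_inner _ _ _ hs' h) !(insert_inner _ _ _ ht'' h').
    rewrite !(insert_inner _ _ _ hs' h) !fmap1 !cmpm1 (IH _ _ _ _ st').
    rewrite pre_on_run on_run_pre; apply: on_run_ext.
    rewrite -!cmpA.
    exact: (climb_c H st st' h h' lt_st Y).
  + have st' : distant N s t.
      by move: (st) far_t lts ltt ht'; rewrite /distant; lia.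
    have h := insideP hm lts; have h' := aboveP ht ltt.
    rewrite !(insert_inner _ _ _ hs' h) !(insert_outerE _ _ _ ht' h').
    rewrite !(insert_inner _ _ _ hs' h) !fmap1 !cmpm1 (IH _ _ _ _ st').
    rewrite pre_on_run on_run_pre; apply: on_run_ext.
    rewrite -!cmpA.
    exact: (climb_pass_c H st st' h h' Y).
- case: s st hs lt_st lts far_t => // s st hs lt_st lts far_t.
  have h := aboveP hs lts; have hs' : s < N := hs.
  have ht0 : above N.+1 t.+1 m by move: h ht lt_st; rewrite /above; lia.
  rewrite !(insert_outerE _ _ _ hs' h) !(insert_outerE _ _ _ ht' ht0).
  rewrite !(insert_outerE _ _ _ hs' h) !fmap1 !cmpm1 (IH _ _ _ _ st).
  rewrite pre_on_run on_run_pre; apply: on_run_ext.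
  rewrite -!cmpA.
  exact: (pass_c H st h ht0 Y).
Qed.

(** The cases compare [m] with [x]: when all letters slide through, the rule moves to the next
    level, and three boundary values of [m] remain. *)
Lemma insert_b N (H : hecke_data C N) : rule_b H.
Proof.
elim: N H => // N IH H c x d hx hx' X P.
have [m [hm [Y [p [f ->]]]]] := on_runE P.
rewrite !insert_pre pre_comp hbN -pre_comp; congr (pre _ _) => {X P f}.
have dx : x < N by [].
have [lt|gt|e] := ltngtP m x.
- case: x d hx hx' dx lt => // x d hx hx' dx lt.
  have h := aboveP hx lt; have h' : above N.+1 x.+2 m by apply: aboveP; lia.
  have dx' : x < N by lia.
  rewrite !(insert_outerE _ _ _ dx' h) !(insert_outerE _ _ _ dx h').
  rewrite !(insert_outerE _ _ _ dx' h) !(insert_outerE _ _ _ dx h').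
  rewrite !fmap1 !cmpm1.
  rewrite (IH (shift H) c x d) pre_on_run on_run_pre; apply: on_run_ext.
  rewrite !fmapM -!cmpA.
  exact: (pass_b H d h h' Y).
- have [e|{}gt] : x.+1 = m \/ x.+1 < m by lia.
    (* The left side absorbs [x] at its first insertion, the right side absorbs [x.+1] at its last:
       this is [hP3]. *)
    case: m / e hm gt => hm _.
    have hm2 : x.+2 < N.+2 by [].
    have h : inside N.+1 x x.+2 by rewrite /inside; lia.
    rewrite insert_top !insert_next !(insert_inner _ _ _ dx h) insert_top.
    rewrite pre_on_run; apply: on_run_ext.
    rewrite !fmap1 !cmpm1.
    have h0 := inside_above h.
    rewrite (climb_base H h d h0) !fmapM !cmpA -haN.
    have /= E := hP3 H d (run H x Y).
    by rewrite -[in LHS]cmpA E !cmpA.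
  have [e|{}gt] : x.+2 = m \/ x.+2 < m by lia.
    (* On the left [x] climbs twice, on the right once. Behind the run [insert_a] merges the two
       raised letters, and [hP6] compares the arrows. *)
    case: m / e hm gt => hm gt.
    have h := insideP hm gt.
    rewrite !(insert_inner _ _ _ dx h) !insert_top !(insert_inner _ _ _ dx h).
    rewrite !insert_top insert_a on_run_pre.
    rewrite pre_on_run; apply: on_run_ext.
    rewrite !fmap1 !cmpm1.
    have h0 := inside_above h.
    rewrite !(climb_base H h d h0) /= !fmapM !cmpA.
    have na := haN H x.+1 (fmap (H x) (pass H h0 Y)).
    rewrite -na -!cmpA [in LHS](cmpA (fmap (H x) (ha H x.+1 _))).
    rewrite -[in LHS]fmapM -na fmapM ![in LHS](cmpA (hb H d _)) -hbN.
    have /(congr1 (fun f => fmap (H x.+1) (fmap (H x) f))) := pass_a H h0 Y.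
    rewrite !fmapM !cmpA => ->.
    have /= E := hP6 H d (run H x Y).
    rewrite -!cmpA; congr (_ \c _); rewrite !cmpA.
    exact: E.
  have dx' : x.+1 < N by lia.
  have h := insideP hm (ltnW gt); have h' := insideP hm gt.
  rewrite !(insert_inner _ _ _ dx h) !(insert_inner _ _ _ dx' h').
  rewrite !(insert_inner _ _ _ dx h) !(insert_inner _ _ _ dx' h').
  rewrite !fmap1 !cmpm1.
  rewrite (IH (shift H) _ _ dx') pre_on_run on_run_pre; apply: on_run_ext.
  rewrite !fmapM -!cmpA.
  exact: (climb_b H d dx' h h' Y).
(* Both sides build the run of length [m.+2], and the climb on the left begins with [hb] itself. *)
- case: x / e d hx hx' dx => d hx hx' dx.
  have h1 : above N.+1 m.+1 m by rewrite /above; lia.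
  have h : inside N.+1 m m.+2 by rewrite /inside; lia.
  rewrite !insert_next (insert_inner _ _ _ dx h) (insert_outerE _ _ _ dx h1).
  rewrite !insert_next pre_on_run; apply: on_run_ext.
  by rewrite !fmap1 !cmpm1 (climb_base H h d h1).
Qed.
End Insertion.

(** * The 0-Hecke monoid *)

Section SplitMono.
Variable C : category.

Definition split_mono (x y : C) (f : hom x y) := exists g, g \c f = idm x.

Lemma split_mono_id (x : C) : split_mono (idm x).
Proof. by exists (idm x); rewrite cmp1m. Qed.

Lemma split_mono_comp (x y z : C) (g : hom y z) (f : hom x y) :
  split_mono g -> split_mono f -> split_mono (g \c f).
Proof.
move=> [g' K] [f' K']; exists (f' \c g').
by rewrite -cmpA (cmpA g') K cmp1m K'.
Qed.

Lemma split_mono_fmap (F : functor C C) (x y : C) (f : hom x y) :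
  split_mono f -> split_mono (fmap F f).
Proof. by move=> [f' K]; exists (fmap F f'); rewrite -fmapM K fmap1. Qed.

Section Slides.
Variables (N : nat) (H : hecke_data C N).

Lemma hc_split s t (st : distant N s t) Y : split_mono (hc H st Y).
Proof. by exists (hc H (distant_sym st) Y); apply: hP1. Qed.

Lemma pass_split x m (h : above N x m) Y : split_mono (pass H h Y).
Proof.
elim: m h => [|m IH] h; first exact: split_mono_id.
by apply: split_mono_comp (hc_split _ _); apply: split_mono_fmap.
Qed.

Lemma climb_split x m (h : inside N x m) Y : split_mono (climb H h Y).
Proof.
elim: m h => [|m IH] h //; rewrite /climb; move: h; case: eqP => [e|ne] h.
  case: m / e {IH} h => h; apply: split_mono_comp (hbI _ _ _).
  exact: (split_mono_fmap (fcomp (H x.+1) (H x))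
    (pass_split (inside_above h) Y)).
by apply: split_mono_comp (hc_split _ _); apply: split_mono_fmap.
Qed.

End Slides.

Lemma insert_split N (H : hecke_data C N) c x (hx : x < N) X (p : elt H X c) :
  split_mono (projT2 p) -> split_mono (projT2 (insert hx p)).
Proof.
elim: N H x hx X p => // N IH H x hx X p sp; rewrite /= /insertS.
set q := existT _ _ _; have : split_mono (projT2 q) by apply: split_mono_id.
move: q (projT2 p) sp (ltn_ord (projT1 p).1) (positionP x (projT1 p).1).
move=> /= q f.
move: (nat_of_ord _) (normal_form _ _ _) q f => m Y q f sf hm v sq.
case: v => [e|e|lt|lt] /=.
- case: m / e {hm} f sf => f sf /=.
  by apply: split_mono_comp; do ?apply: split_mono_fmap.
- case: m / e {hm} f sf => f sf /=.
  apply: split_mono_comp; first by do !apply: split_mono_fmap.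
  by apply: split_mono_comp (haI _ _ _) _; apply: split_mono_fmap.
- apply: split_mono_comp; first by apply: split_mono_fmap; apply: IH.
  by apply: split_mono_comp (climb_split _ _ _) _; apply: split_mono_fmap.
- case: x hx lt => // x hx lt /=.
  apply: split_mono_comp; first by apply: split_mono_fmap; apply: IH.
  by apply: split_mono_comp (pass_split _ _ _) _; apply: split_mono_fmap.
Qed.

(** The witness has all runs empty, with the identity of [c] as its arrow. *)
Lemma start_exists N (H : hecke_data C N) c :
  exists p : elt H c c, split_mono (projT2 p).
Proof.
elim: N H => [|N IH] H.
  by exists (existT _ tt (idm c)); apply: split_mono_id.
have [p sp] := IH (shift H).
exists (on_run (m := 0) (ltn0Sn _) p (idm c)).
by apply: split_mono_comp; [apply: split_mono_fmap | apply: split_mono_id].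
Qed.

Lemma pre_split N (H : hecke_data C N) c X Y (p : elt H X c) (h k : hom Y X) :
  split_mono (projT2 p) -> pre h p = pre k p -> h = k.
Proof. by case: p => q f /= [g K] E; apply: (cmp_mono K (existT_inj E)). Qed.

End SplitMono.

(** * The structure carried by an action that satisfies the nine families *)

Section HeckeActions.
Variables (n : nat) (C : category).
Local Notation N := n.+1.
Variable F : paction (hecke_sys N) C.
Hypothesis satF : @satisfies (hecke_sys N) C (@hecke_P N) F.

(* The letters are numbered backwards: [letter_of i] is T_(N - i). *)
Definition letter_of (i : nat) : 'I_N := rev_ord (inord i).

Lemma consec_letter i : i.+1 < N -> consec (letter_of i.+1) (letter_of i).
Proof. by move=> h; rewrite /consec /= !inordK //; lia. Qed.

Lemma far_letter s t : distant N s t -> far (letter_of s) (letter_of t).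
Proof.
by rewrite /distant /far /= => /and3P[hs ht h]; rewrite !inordK //; lia.
Qed.

Local Notation hrule := (rule (hecke_sys N)).
(** Out of range, [inord] returns a default letter. This is harmless: [b] and [c] carry bounds, and
    the relation on [a] alone holds for every letter. *)
Let G i : functor C C := F (letter_of i).
Let a i Y : hom (G i (G i Y)) (G i Y) :=
  pact_tau F (ra (letter_of i) : hrule) Y.
Let b i (h : i.+1 < N) Y :
    hom (G i (G i.+1 (G i Y))) (G i.+1 (G i (G i.+1 Y))) :=
  pact_tau F (rb (consec_letter h) : hrule) Y.
Let c s t (h : distant N s t) Y : hom (G s (G t Y)) (G t (G s Y)) :=
  pact_tau F (rc (far_letter h) : hrule) Y.

Lemma tau_step_cons (S : rewriting_system) (A : paction S C) x w1
    (r : rule S) w2 Y :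
  tau_step A (Step (x :: w1) r w2) Y =
  fmap (A x) (tau_step A (Step w1 r w2) Y).
Proof. by rewrite /= !cmp1m !cmpm1 !fmapM !cmpA. Qed.

Lemma tau_step_nil (S : rewriting_system) (A : paction S C) (r : rule S) w Y :
  tau_step A (Step [::] r w) Y =
  bwd (word_cat A (rhs r) w) Y \c
    (pact_tau A r (wordF A w Y) \c word_cat A (lhs r) w Y).
Proof. by rewrite /= cmp1m cmpm1. Qed.

Lemma tau_step_ra i w Y :
  tau_step F (Step [::] (ra i : hrule) w) Y =
  pact_tau F (ra i : hrule) (wordF F w Y).
Proof. by rewrite tau_step_nil /= !(fmap1, cmp1m, cmpm1). Qed.

Lemma tau_step_rb i j (h : consec i j) w Y :
  tau_step F (Step [::] (rb h : hrule) w) Y =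
  pact_tau F (rb h : hrule) (wordF F w Y).
Proof. by rewrite tau_step_nil /= !(fmap1, cmp1m, cmpm1). Qed.

Lemma tau_step_rc s t (h : far s t) w Y :
  tau_step F (Step [::] (rc h : hrule) w) Y =
  pact_tau F (rc h : hrule) (wordF F w Y).
Proof. by rewrite tau_step_nil /= !(fmap1, cmp1m, cmpm1). Qed.

Arguments tau_step : simpl never.
Lemma tau_path_cons (S : rewriting_system) (A : paction S C) u v w
    (s : step u v) (p : rpath v w) Y :
  tau_path A (pcons s p) Y = tau_path A p Y \c tau_step A s Y.
Proof. by []. Qed.

Lemma tau_path_nil (S : rewriting_system) (A : paction S C) u Y :
  tau_path A (@pnil S u) Y = idm (wordF A u Y).
Proof. by []. Qed.

Ltac unfold_step := match goal with
  | |- context [@ntc _ _ _ _ (@tau_path _ _ ?A _ _ (pcons ?s ?p)) ?Y] =>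
      rewrite (tau_path_cons A s p Y)
  | |- context [@ntc _ _ _ _ (@tau_path _ _ ?A _ _ (@pnil _ ?u)) ?Y] =>
      rewrite (tau_path_nil A u Y)
  | |- context [@ntc _ _ _ _
         (@tau_step _ _ ?A _ _ (@Step _ (?x :: ?w1) ?r ?w2)) ?Y] =>
      rewrite (tau_step_cons A x w1 r w2 Y)
  | |- context [@ntc _ _ _ _ (@tau_step _ _ _ _ _ (@Step _ _ (ra ?i) ?w)) ?Y] =>
      rewrite (tau_step_ra i w Y)
  | |- context [@ntc _ _ _ _ (@tau_step _ _ _ _ _ (@Step _ _ (rb ?h) ?w)) ?Y] =>
      rewrite (tau_step_rb h w Y)
  | |- context [@ntc _ _ _ _ (@tau_step _ _ _ _ _ (@Step _ _ (rc ?h) ?w)) ?Y] =>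
      rewrite (tau_step_rc h w Y)
  end.
Ltac unfold_paths E :=
  have := E;
  repeat unfold_step; rewrite ?cmp1m ?cmpA; exact.

(** Kept transparent, since the functor of index [i] has to reduce to [F (letter_of i)] when
    insertion is read on actual letters. *)
Definition hecke_data_of : hecke_data C N.
Proof.
refine (@HeckeData C N G a b c _ _ _ _ _ _ _ _ _ _ _ _ _ _).
- by move=> i Y Z f; apply: (ntN (pact_tau F (ra (letter_of i) : hrule))).
- by move=> i h Y Z f; apply: (ntN (pact_tau F (rb (consec_letter h) : hrule))).
- by move=> s t h Y Z f; apply: (ntN (pact_tau F (rc (far_letter h) : hrule))).
- by move=> i Y; eexists; apply: (fwdK (pact_tau F (ra (letter_of i) : hrule))).
- by move=> i h Y; eexists; apply: (fwdK (pact_tau F (rb (consec_letter h) : hrule))).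
- move=> s t h h' Y.
  by unfold_paths (satF (P1 (far_letter h) (far_letter h')) Y).
- by move=> k Y; unfold_paths (satF (P2 (letter_of k)) Y).
- by move=> k h Y; unfold_paths (satF (P3 (consec_letter h)) Y).
- by move=> k h Y; unfold_paths (satF (P4 (consec_letter h)) Y).
- by move=> s t h Y; unfold_paths (satF (P5 (far_letter h)) Y).
- by move=> k h Y; unfold_paths (satF (P6 (consec_letter h)) Y).
- move=> s t h ts ts' Y.
  by unfold_paths (satF (P7 (consec_letter h) (far_letter ts)
    (far_letter ts')) Y).
- move=> i j k ji ki kj Y.
  by unfold_paths (satF (P8 (far_letter ji) (far_letter ki) (far_letter kj)) Y).
- move=> k h1 h f f' Y.
  by unfold_paths (satF (P9 (consec_letter h) (consec_letter h1)
    (far_letter f) (far_letter f')) Y).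
Defined.

Lemma letter_ofK (x : 'I_N) : letter_of (rev_ord x) = x.
Proof. by rewrite /letter_of inord_val rev_ordK. Qed.

Lemma letterP (x : 'I_N) : exists2 i, i < N & x = letter_of i.
Proof. by exists (rev_ord x); [apply: ltn_ord | rewrite letter_ofK]. Qed.

Lemma rev_letter_of i : i < N -> rev_ord (letter_of i) = i :> nat.
Proof. by move=> h; rewrite rev_ordK inordK. Qed.

Local Notation H := hecke_data_of.

(** The cast along [letter_ofK] disappears in [insert_letterE], where the letter is given by its
    backward index. *)
Definition insert_letter (x : 'I_N) d X (p : elt H X d) : elt H (F x X) d :=
  match letter_ofK x in _ = y return elt H (F y X) d with
  | erefl => insert (ltn_ord (rev_ord x)) p
  end.

Lemma insert_letterE i (h : i < N) d X (p : elt H X d) :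
  insert_letter (letter_of i) p = insert h p.
Proof.
rewrite /insert_letter; move: (letter_ofK _) (ltn_ord _).
rewrite (rev_letter_of h) => e h'.
by rewrite (Prop_irrelevance e erefl) (bool_irrelevance h' h).
Qed.

Lemma insert_letter_pre (x : 'I_N) d X Y (k : hom Y X) (p : elt H X d) :
  insert_letter x (pre k p) = pre (fmap (F x) k) (insert_letter x p).
Proof.
by have [i h ->] := letterP x; rewrite !(insert_letterE h) insert_pre.
Qed.

Lemma insert_letter_split (x : 'I_N) d X (p : elt H X d) :
  split_mono (projT2 p) -> split_mono (projT2 (insert_letter x p)).
Proof.
by have [i h ->] := letterP x; rewrite (insert_letterE h); apply: insert_split.
Qed.

Local Notation insert_word := (opw (F := F) (fun x X => @insert_letter x _ X)).

Lemma insert_rule (r : hrule) d X (p : elt H X d) :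
  insert_word (lhs r) p = pre (pact_tau F r X) (insert_word (rhs r) p).
Proof.
case: r => [x|x' x|x y] /=.
- have [i hi ->] := letterP x; rewrite !(insert_letterE hi).
  exact: (@insert_a _ _ H d i hi X p).
- have [i hi ->] := letterP x; have [j hj ->] := letterP x' => h.
  have e : j = i.+1.
    by move: h; rewrite /consec /= !inordK // => /eqP; lia.
  subst j.
  rewrite !(insert_letterE hi, insert_letterE hj).
  rewrite (bool_irrelevance h (consec_letter hj)).
  exact: (@insert_b _ _ H d i hj hi hj X p).
- have [s hs ->] := letterP x; have [t ht ->] := letterP y => h.
  have st : distant N s t.
    by move: h; rewrite /far /distant hs ht /= !inordK //; lia.
  rewrite !(insert_letterE hs, insert_letterE ht).
  rewrite (bool_irrelevance h (far_letter st)).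
  exact: (@insert_c _ _ H d s t st hs ht X p).
Qed.

Lemma hecke_canonical_unique u v (f f' : nat_trans (wordF F u) (wordF F v)) :
  canonical f -> canonical f' -> forall d, f d = f' d.
Proof.
move=> cf cf' d; have [p0 sp0] := start_exists H d.
apply: (@canonical_unique _ _ F d (fun X => elt H X d) (fun X Y k p => pre k p)
  (fun x X p => insert_letter x p) (fun X p => split_mono (projT2 p))
  _ _ _ _ _ _ p0 sp0 _ _ _ _ cf cf').
- by move=> X p; apply: pre_id.
- by move=> *; apply: pre_comp.
- by move=> *; apply: insert_letter_pre.
- by move=> r X p; apply: insert_rule.
- by move=> *; apply: insert_letter_split.
- by move=> X Y p k k' sp E; apply: pre_split sp E.
Qed.

End HeckeActions.

Theorem mainTheorem10 (n : nat) (hn : 1 <= n) :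
  coherent_presentation (hecke_presentation n) (@hecke_P n).
Proof.
(* The successor form of [n] makes the type of letters inhabited, as [inord] requires. *)
case: n hn => // n _; apply: coherence_criterion => C F satF u v f f'.
exact: (hecke_canonical_unique satF).
Qed.
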